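(* Let $T>0$, $H\in(0,1)$, $H\neq 1/2$, $x_0\in\mathbb{R}$, $b\in C^1_b$, $\sigma\in C^2_b$, and assume that the equation $dX_t=b(X_t)\,dt+\sigma(X_t)\,dB^H_t$, $t\in(0,T]$, $X_0=x_0$, has a unique solution $X$, given by the Doss-Sussmann representation $X_t=h(Y_t,B^H_t)$. Let $|H-1/2|<\beta<1/2$, let $B^n$ be the transport-process approximation of $B^H$ (with parameter $\beta$), and let $X^n_t=h^n(Y^{n,n^2}_t,B^n_t)$, where $h^n$ and $Y^{n,m}$ are the Euler schemes defined in the context. Then for each $\delta>0$ such that $\delta<\beta$ and $\beta+\delta<1/2$ there exists a positive constant $C$ such that $$P\left(\limsup_{n\to\infty}\left\{\sup_{0\le t\le T}|X_t-X^n_t|>C\,n^{-1/2+\beta+\delta}(\log n)^{5/2}\right\}\right)=0,$$ where $\limsup$ is the limit superior of a sequence of events.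
   Context: $C^i_b$ is the space of bounded functions $\mathbb{R}\to\mathbb{R}$ with continuous bounded derivatives of order $\le i$. Doss-Sussmann representation: $h:\mathbb{R}^2\to\mathbb{R}$ is the solution of $\frac{\partial h}{\partial x_2}(x_1,x_2)=\sigma(h(x_1,x_2))$, $h(x_1,0)=x_1$; one has $\frac{\partial h}{\partial x_1}(x_1,x_2)=\exp\left(\int_0^{x_2}\sigma'(h(x_1,s))ds\right)$. The process $Y$ is the pathwise solution of $Y'_t=\exp\left(-\int_0^{B^H_t}\sigma'(h(Y_t,s))ds\right)b(h(Y_t,B^H_t))$, $Y_0=x_0$. The solution of the stochastic differential equation is $X_t=h(Y_t,B^H_t)$. Fractional Brownian motion: $B^H$ is the centered Gaussian process with covariance $\frac12(s^{2H}+t^{2H}-|s-t|^{2H})$, realized as $B^H_t=C_H\left(\int_{-\infty}^0 f_t(s)dB(s)+\int_0^t g_t(s)dB(s)\right)$, $0\le t\le T$, where $B$ is a two-sided Brownian motion on $\mathbb{R}$, $C_H>0$ is the normalizing constant, $f_t(s)=(t-s)^{H-1/2}-(-s)^{H-1/2}$ for $s<0\le t$ and $g_t(s)=(t-s)^{H-1/2}$ for $s<t$. Fix $a<0$. Let $B_1$ be the restriction of $B$ to $[0,T]$, $B_2$ the restriction of $B$ to $[a,0]$, and $B_3(s)=sB(1/s)$ for $s\in[1/a,0)$, $B_3(0)=0$. Transport processes: a (uniform) transport process $Z^n$ is the position on the real line of a particle which starts from $0$ with velocity $+n$ or $-n$ (probability $1/2$ each) and switches the sign of its velocity at the ends of consecutive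 independent exponential holding times with parameter $n^2$; so its paths are continuous and piecewise linear with slopes $\pm n$. $Z^n_1,Z^n_2,Z^n_3$ are transport processes constructed from $B_1,B_2,B_3$ on the same probability space (via Skorohod embedding) so as to approximate them strongly; $Z^n_2$ and $Z^n_3$ are run backward in time from time $0$ along the negative half-line. Approximation $B^n$: let $\varepsilon_n=-n^{-\beta/|H-1/2|}$. Integrals with respect to $Z^n_i$ are pathwise, and $\partial_sf_t(1/v)$ is the derivative of $s\mapsto f_t(s)$ evaluated at $s=1/v$. For $H>1/2$, $$B^n_t=C_H\Big(\int_0^t g_t(s)dZ^n_1(s)+\int_a^0 f_t(s)dZ^n_2(s)+f_t(a)Z^n_2(a)+\int_{1/a}^0\Big(-\int_{1/a}^{s\wedge\varepsilon_n}\partial_sf_t\big(\tfrac1v\big)\tfrac{1}{v^3}dv\Big)dZ^n_3(s)\Big),$$ and for $H<1/2$, $$B^n_t=C_H\Big(\int_0^{(t+\varepsilon_n)\vee0}g_t(s)dZ^n_1(s)+\int_{(t+\varepsilon_n)\vee0}^t g_t(\varepsilon_n+s)dZ^n_1(s)+\int_a^{\varepsilon_n}f_t(s)dZ^n_2(s)+f_t(a)Z^n_2(a)+\int_{1/a}^0\Big(-\int_{1/a}^{s}\partial_sf_t\big(\tfrac1v\big)\tfrac{1}{v^3}dv\Big)dZ^n_3(s)\Big).$$ Known fact (earlier work, taken as given): with this construction, if $|H-1/2|<\beta<1/2$, then for each $q>0$ there is $C>0$ with $P\left(\sup_{0\le t\le T}|B^H_t-B^n_t|>Cn^{-1/2+\beta}(\log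 n)^{5/2}\right)=o(n^{-q})$ as $n\to\infty$. Euler scheme $h^n$ for $h$: for $n\ge1$ put $r_n=1/n$, $y^n_{\pm i}=\pm i/n$, $0\le i\le n^2$ (a partition of $[-n,n]$). Set $h^n(x,y)=0$ if $(x,y)\notin[-n,n]\times[-n,n]$. For $(x,y)\in[-n,n]\times[-n,n]$ and $k=0,\dots,n^2-1$: $h^n(x,0)=x$, $h^n(x,y^n_{k+1})=h^n(x,y^n_k)+r_n\sigma(h^n(x,y^n_k))$, $h^n(x,y^n_{-(k+1)})=h^n(x,y^n_{-k})-r_n\sigma(h^n(x,y^n_{-k}))$, and by linear interpolation $h^n(x,y)=h^n(x,y^n_k)+(y-y^n_k)\sigma(h^n(x,y^n_k))$ if $y^n_k\le y<y^n_{k+1}$, $h^n(x,y)=h^n(x,y^n_{-k})-(y^n_{-k}-y)\sigma(h^n(x,y^n_{-k}))$ if $y^n_{-(k+1)}<y\le y^n_{-k}$. Euler scheme $Y^{n,m}$: let $f^n(x,y)=\exp\left(-\int_0^y\sigma'(h^n(x,u))du\right)b(h^n(x,y))$. For $m\ge1$ let $r_m=T/m$, $t_k=kr_m$, $0\le k\le m$. Then $Y^{n,m}_0=x_0$, $Y^{n,m}_{t_{k+1}}=Y^{n,m}_{t_k}+r_mf^n(Y^{n,m}_{t_k},B^n_{t_k})$ for $k=0,\dots,m-1$, and $Y^{n,m}_t=Y^{n,m}_{t_k}+(t-t_k)f^n(Y^{n,m}_{t_k},B^n_{t_k})$ if $t_k\le t<t_{k+1}$. $Y^{n,n^2}$ is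 $Y^{n,m}$ with $m=n^2$. *)

(* Defs.v *)
From HB Require Import structures.
From mathcomp Require Import all_boot all_order all_algebra.
From mathcomp Require Import all_classical all_reals all_analysis.

Set Implicit Arguments.
Unset Strict Implicit.
Unset Printing Implicit Defensive.

Import Order.TTheory GRing.Theory Num.Theory.
Import numFieldNormedType.Exports.

Local Open Scope classical_set_scope.
Local Open Scope ring_scope.

Section deterministic.
Context {R : realType}.
Implicit Types (f g phi z sigma b : R -> R) (x y t s : R) (n m k : nat).

Definition C_b (i : nat) f : Prop :=
  forall k, (k <= i)%N ->
    [/\ (k < i)%N -> forall x, derivable (derive1n k f) x 1,
        continuous (derive1n k f)
      & exists M, forall x, `|derive1n k f x| <= M].

(* Integral over the oriented interval: the upper bound may lie below the lower
   one, as in \int_0^y with y < 0. *)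
Definition oriented_integral (c d : R) f : R :=
  if c <= d then \int[lebesgue_measure]_(x in `[c, d]) f x
  else - \int[lebesgue_measure]_(x in `[d, c]) f x.

(* Pathwise \int_c^d phi dz. The integrator z is continuous and piecewise
   linear, so that dz has density z' with respect to Lebesgue measure; z' is
   undefined only at the finitely many breakpoints in [c, d]. *)
Definition path_integral (c d : R) phi z : R :=
  oriented_integral c d (fun s => phi s * derive1 z s).

Definition mvn_f (H t s : R) : R :=
  (t - s) `^ (H - 2^-1) - (- s) `^ (H - 2^-1).

Definition mvn_g (H t s : R) : R := (t - s) `^ (H - 2^-1).

Definition eps (H beta : R) n : R :=
  - (n%:R `^ (- (beta / `|H - 2^-1|))).

(* - \int_{1/a}^r (d/ds f_t)(1/v) / v^3 dv *)
Definition tail_kernel (H a t r : R) : R :=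
  - oriented_integral a^-1 r (fun v => derive1 (mvn_f H t) v^-1 / v ^+ 3).

(* One path of B^n, as a function of the three transport paths. *)
Definition transport_fbm (CH H beta a : R) n (z1 z2 z3 : R -> R) t : R :=
  let e := eps H beta n in
  if 2^-1 < H then
    CH * (path_integral 0 t (mvn_g H t) z1
          + path_integral a 0 (mvn_f H t) z2
          + mvn_f H t a * z2 a
          + path_integral a^-1 0
              (fun s => tail_kernel H a t (Order.min s e)) z3)
  else
    let c := Order.max (t + e) 0 in
    CH * (path_integral 0 c (mvn_g H t) z1
          + path_integral c t (fun s => mvn_g H t (e + s)) z1
          + path_integral a e (mvn_f H t) z2
          + mvn_f H t a * z2 a
          + path_integral a^-1 0 (fun s => tail_kernel H a t s) z3).

(* euler_h_node sigma c x k is h^n(x, y_k) for c = 1/n and h^n(x, y_{-k}) for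
   c = - 1/n. *)
Definition euler_h_node sigma (c x : R) k : R :=
  iter k (fun v => v + c * sigma v) x.

(* For 0 <= y the index k satisfies y_k <= y < y_{k+1}; for y < 0 it satisfies
   y_{-(k+1)} < y <= y_{-k}. *)
Definition euler_h sigma n x y : R :=
  if (`|x| <= n%:R) && (`|y| <= n%:R) then
    let k := Num.truncn (n%:R * `|y|) in
    if 0 <= y then
      let v := euler_h_node sigma n%:R^-1 x k in
      v + (y - k%:R / n%:R) * sigma v
    else
      let v := euler_h_node sigma (- n%:R^-1) x k in
      v - (- (k%:R / n%:R) - y) * sigma v
  else 0.

Definition doss_drift (b sigma : R -> R) (h : R -> R -> R) x y : R :=
  expR (- oriented_integral 0 y (fun u => derive1 sigma (h x u))) * b (h x y).

Fixpoint euler_Y_node (F : R -> R -> R) (Bn : R -> R) (T : R) m (x0 : R) k : R :=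
  if k is k'.+1 then
    let y := euler_Y_node F Bn T m x0 k' in
    y + T / m%:R * F y (Bn (k'%:R * (T / m%:R)))
  else x0.

(* The index k satisfies t_k <= t < t_{k+1}, and k = m for t = T. *)
Definition euler_Y (F : R -> R -> R) (Bn : R -> R) (T : R) m (x0 t : R) : R :=
  let k := Num.truncn (t / (T / m%:R)) in
  let y := euler_Y_node F Bn T m x0 k in
  y + (t - k%:R * (T / m%:R)) * F y (Bn (k%:R * (T / m%:R))).

Definition step_fun (l : seq (R * (R * R))) x : R :=
  \sum_(p <- l) p.1 * \1_(`]p.2.1, p.2.2]) x.

End deterministic.

Section probabilistic.
Context {R : realType} {d : measure_display} {Omega : measurableType d}.
Variable P : probability Omega R.
Implicit Types (X Y Z : R -> Omega -> R) (T : R).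

(* Outer probability: it agrees with P on measurable sets, and is 0 exactly on
   the sets included in a measurable null set. It gives a meaning to the
   probability of events such as {sup_t |X_t| > c} without requiring a proof of
   measurability (the value of P on a non-measurable set being arbitrary). *)
Definition outer_prob (A : set Omega) : \bar R := mu_ext P A.

Definition sup_exceeds T X Y (c : R) : set Omega :=
  [set w | (c%:E < ereal_sup [set `|X t w - Y t w|%:E | t in `[0%R, T]])%E].

Definition has_law (V : Omega -> R) (mu : set R -> \bar R) : Prop :=
  forall A, measurable A -> P (V @^-1` A) = mu A.

Definition mutually_independent (I : choiceType) (V : I -> Omega -> R) : Prop :=
  forall (J : seq I) (A : I -> set R), uniq J ->
    (forall i, measurable (A i)) ->
    P (\bigcap_(i in [set` J]) (V i @^-1` A i))
    = (\prod_(i <- J) P (V i @^-1` A i))%E.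

(* normal_prob takes the standard deviation, and is not the point mass for
   standard deviation 0. *)
Definition gaussian_var (V : Omega -> R) : Prop :=
  exists m s : R, has_law V (fun A => if s == 0 then \d_m A else normal_prob m s A).

Definition fractional_brownian (H T : R) (BH : R -> {RV P >-> R}) : Prop :=
  [/\ forall l : seq (R * R), {in l, forall p, p.2 \in `[0, T]} ->
        gaussian_var (fun w => \sum_(p <- l) p.1 * BH p.2 w),
      forall t, t \in `[0, T] -> ('E_P[BH t] = 0)%E,
      forall s t, s \in `[0, T] -> t \in `[0, T] ->
        covariance P (BH s) (BH t)
        = (2^-1 * (s `^ (2 * H) + t `^ (2 * H) - `|s - t| `^ (2 * H)))%:E
    & {ae P, forall w, {within `[0, T], continuous (fun t => BH t w)}}].

Definition two_sided_brownian (B : R -> {RV P >-> R}) : Prop :=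
  [/\ {ae P, forall w, B 0 w = 0},
      forall s t, s < t ->
        has_law (fun w => B t w - B s w) (normal_prob 0 (Num.sqrt (t - s))),
      forall u : nat -> R, {homo u : i j / (i < j)%N >-> i < j} ->
        mutually_independent (fun (k : nat) w => B (u k.+1) w - B (u k) w)
    & {ae P, forall w, continuous (fun t => B t w)}].

Definition step_integral (B : R -> Omega -> R) (l : seq (R * (R * R)))
    (w : Omega) : R :=
  \sum_(p <- l) p.1 * (B p.2.2 w - B p.2.1 w).

(* I is the Wiener integral \int_R f dB, the L^2(P)-limit of the integrals of
   step functions converging to f in L^2(R). *)
Definition wiener_integral (B : R -> Omega -> R) (f : R -> R)
    (I : Omega -> R) : Prop :=
  exists l : nat -> seq (R * (R * R)),
    [/\ forall k, {in l k, forall p, p.2.1 <= p.2.2},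
        (fun k => \int[lebesgue_measure]_x ((f x - step_fun (l k) x) ^+ 2)%:E)%E
          @ \oo --> 0%E
      & (fun k => \int[P]_w ((I w - step_integral B (l k) w) ^+ 2)%:E)%E
          @ \oo --> 0%E].

Definition mandelbrot_van_ness (CH H T : R) (B : R -> Omega -> R)
    (BH : R -> Omega -> R) : Prop :=
  forall t, t \in `[0, T] ->
    exists I1 I2 : {RV P >-> R},
      [/\ wiener_integral B (fun s => mvn_f H t s * \1_(`]-oo, 0[) s) I1,
          wiener_integral B (fun s => mvn_g H t s * \1_(`[0, t[) s) I2
        & {ae P, forall w, BH t w = CH * (I1 w + I2 w)}].

Definition switch_time (e : nat -> Omega -> R) (k : nat) (w : Omega) : R :=
  \sum_(j < k) e j w.

(* Z runs along [0, +oo[; V is the initial velocity and e the sequence of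
   holding times. *)
Definition transport_process (n : nat) Z : Prop :=
  exists (V : {RV P >-> R}) (e : nat -> {RV P >-> R}),
    [/\ P (V @^-1` [set n%:R]) = (2^-1)%:E /\
        P (V @^-1` [set - n%:R]) = (2^-1)%:E,
        forall k, has_law (e k) (exponential_prob (n%:R ^+ 2)),
        mutually_independent
          (fun k : nat => if k is k'.+1 then e k' : Omega -> R else V)
      & {ae P, forall w,
          [/\ Z 0 w = 0,
              switch_time e k w @[k --> \oo] --> +oo
            & forall (k : nat) (t : R),
                switch_time e k w <= t <= switch_time e k.+1 w ->
                Z t w = Z (switch_time e k w) w
                        + (-1) ^+ k * V w * (t - switch_time e k w)]}].

Definition backward Z : R -> Omega -> R := fun s => Z (- s).

Definition inverted (B : R -> Omega -> R) : R -> Omega -> R :=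
  fun s w => if s == 0 then 0 else s * B s^-1 w.

Definition strongly_approximates (c e : R) (Z : nat -> R -> Omega -> R)
    (B : R -> Omega -> R) : Prop :=
  {ae P, forall w,
    {uniform `[c, e], (fun n t => Z n t w) @ \oo --> (fun t => B t w)}}.

Definition fbm_approx (CH H beta a : R) (Z1 Z2 Z3 : nat -> R -> Omega -> R)
    (n : nat) : R -> Omega -> R :=
  fun t w => transport_fbm CH H beta a n
    (fun s => Z1 n s w) (fun s => Z2 n s w) (fun s => Z3 n s w) t.

Definition flow (sigma : R -> R) (h : R -> R -> R) : Prop :=
  forall x1, h x1 0 = x1 /\
    forall x2, is_derive x2 (1 : R) (h x1) (sigma (h x1 x2)).

Definition doss_pathwise_solution T (x0 : R) (b sigma : R -> R)
    (h : R -> R -> R) (BH : R -> Omega -> R) Y : Prop :=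
  {ae P, forall w,
    [/\ {within `[0, T], continuous (fun t => Y t w)},
        Y 0 w = x0
      & forall t, t \in `]0, T[ ->
          is_derive t (1 : R) (fun s => Y s w)
            (doss_drift b sigma h (Y t w) (BH t w))]}.

(* J u B S reads: u is integrable with respect to B and S_t = \int_0^t u dB.
   No particular theory of integration with respect to fractional Brownian
   motion is singled out. *)
Definition sde_solution
    (J : (R -> Omega -> R) -> (R -> Omega -> R) -> (R -> Omega -> R) -> Prop)
    T (x0 : R) (b sigma : R -> R) (BH : R -> Omega -> R) X : Prop :=
  exists S : R -> Omega -> R,
    J (fun t w => sigma (X t w)) BH S /\
    {ae P, forall w,
      [/\ {within `[0, T], continuous (fun t => X t w)},
          X 0 w = x0
        & forall t, t \in `]0, T] ->
            X t w = x0 + \int[lebesgue_measure]_(s in `[0, t]) b (X s w)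
                    + S t w]}.

Definition unique_sde_solution
    (J : (R -> Omega -> R) -> (R -> Omega -> R) -> (R -> Omega -> R) -> Prop)
    T (x0 : R) (b sigma : R -> R) (BH : R -> Omega -> R) X : Prop :=
  sde_solution J T x0 b sigma BH X /\
  forall X', sde_solution J T x0 b sigma BH X' ->
    {ae P, forall w, forall t, t \in `[0, T] -> X' t w = X t w}.

Definition sde_approx T (x0 : R) (b sigma : R -> R)
    (Bn : nat -> R -> Omega -> R) (n : nat) : R -> Omega -> R :=
  fun t w =>
    let hn := euler_h sigma n in
    hn (euler_Y (doss_drift b sigma hn) (fun s => Bn n s w) T (n ^ 2)%N x0 t)
       (Bn n t w).

End probabilistic.

(* Main.v *)
(** The rate is governed by [rho = 1/2 - beta], and [|H - 1/2| < beta] forces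
    [rho < H].

    Pathwise, the error of the scheme is bounded by a random constant times
    [n^(-rho) (ln n)^(5/2)], and the factor [n^delta] absorbs that constant, so
    that any deterministic [C] works.  The bound comes from comparing
    [Y' = F(Y, B^H)] with an Euler scheme whose drift [F^n(., B^n)] is perturbed
    in three ways: [|h - h^n| = O(1/n)] (Euler error for [h]),
    [|B^H - B^n| = O(n^(-rho) (ln n)^(5/2))] (Borel-Cantelli applied to the
    known estimate with [q = 2]), and the oscillation of [B^H] over the mesh
    [T/n^2].  The last one is [O(n^(-rho))] because [B^H] is Hoelder of exponent
    [rho/2 < H]: Gaussian tails of the dyadic increments, Borel-Cantelli and
    chaining. *)

Require Import Defs.
From mathcomp Require Import all_boot all_order all_algebra.
From mathcomp Require Import all_classical all_reals all_analysis.
From mathcomp Require Import measurable_realfun ring lra.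

Import Order.TTheory GRing.Theory Num.Theory.
Import numFieldNormedType.Exports.

Local Open Scope classical_set_scope.
Local Open Scope ring_scope.

Set Implicit Arguments.
Unset Strict Implicit.
Unset Printing Implicit Defensive.

(** * Real-variable preliminaries *)

(** Two features of the scheme shape the comparison. The function [h^n] is cut off outside [-n,n]^2,
    so the Euler iterates need an a priori bound that keeps them in this square for large n. And no
    regularity of [h^n] in its first variable is used: the accumulated error is propagated with the
    Lipschitz constant of the exact drift [F], while [F] and [F^n] are compared only at a common
    point. The drift is bounded and Lipschitz on strips |y| <= M only, with constants exponential in
    M. Here M bounds |B^H| along the path, so constants and thresholds are random; this is harmless
    because a limit superior of events only involves large n, path by path. Suprema over uncountably
    many times are handled by outer probability, whose countable subadditivity is enough for
    Borel-Cantelli. A Gaussian variable comes with an unspecified mean and deviation; Chebyshev's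
    inequality ties both to the covariance, which avoids computing moments of the normal law. *)

Lemma C_b_bounded (R : realType) i (f : R -> R) : C_b i f ->
  exists2 M : R, 0 <= M & forall x, `|f x| <= M.
Proof.
move=> /(_ 0%N isT)[_ _ [M fM]]; exists M => //.
by rewrite (le_trans _ (fM 0)).
Qed.

Lemma C_bS_derive (R : realType) i (f : R -> R) : C_b i.+1 f -> C_b i (derive1 f).
Proof.
move=> Cf k ki; have [df cf bf] := Cf k.+1 ki.
rewrite derive1Sn in df cf bf.
by split => // ki'; apply: df.
Qed.

Lemma C_bS_lipschitz (R : realType) i (f : R -> R) : C_b i.+1 f ->
  exists2 M : R, 0 <= M & forall x y, `|f x - f y| <= M * `|x - y|.
Proof.
move=> Cf; have [M M0 fM] := C_b_bounded (C_bS_derive Cf); exists M => // x y.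
have [/(_ isT) df _ _] := Cf 0%N isT.
have cf (z : R) : {for z, continuous f}.
  by apply/differentiable_continuous/derivable1_diffP/df.
wlog xy : x y / y <= x.
  move=> H; have [/H//|/ltW/H] := leP y x.
  by rewrite distrC (distrC x).
have [|c _ ->] := @MVT_segment R f (derive1 f) y x xy _
    (continuous_subspaceT cf).
  by move=> z _; rewrite derive1E; apply/derivableP/df.
by rewrite normrM ler_wpM2r.
Qed.

(** Serves twice: for [h] as a function of its second variable, and for [Y] as a function of time.
    The slopes [s k] are arbitrary, so that the scheme may follow a perturbed drift; the
    perturbation goes into [eta]. The mean value theorem on each cell gives a recursion under which
    the bound [t * eta * expR (L * t)] is stable. *)
Lemma euler_scheme_error (R : realType) (phi dphi : R -> R) (A r L eta : R)
    (v s : nat -> R) :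
  0 < r -> 0 <= L -> 0 <= eta ->
  (forall t, t \in `]0, A[ -> is_derive t (1 : R) phi (dphi t)) ->
  {within `[0, A], continuous phi} ->
  v 0%N = phi 0 ->
  (forall k, v k.+1 = v k + r * s k) ->
  (forall k t, t \in `]0, A[ -> k%:R * r <= t <= k.+1%:R * r ->
     `|dphi t - s k| <= L * `|phi (k%:R * r) - v k| + eta) ->
  forall k t, t \in `[0, A] -> k%:R * r <= t <= k.+1%:R * r ->
    `|phi t - (v k + (t - k%:R * r) * s k)| <= t * eta * expR (L * t).
Proof.
move=> r0 L0 eta0 dphiE cphi v0 vS slope.
have cell k t : t \in `[0, A] -> k%:R * r <= t <= k.+1%:R * r ->
    `|phi t - (v k + (t - k%:R * r) * s k)| <=
    `|phi (k%:R * r) - v k| +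
     (t - k%:R * r) * (L * `|phi (k%:R * r) - v k| + eta).
  move=> tA /andP[kt tk].
  have tk0 : 0 <= k%:R * r by rewrite mulr_ge0// ltW.
  have : {within `[k%:R * r, t], continuous phi}.
    apply: continuous_subspaceW cphi; apply: subset_itv; rewrite bnd_simp//.
    by move: tA; rewrite in_itv/= => /andP[].
  move: kt; rewrite le_eqVlt => /predU1P[-> _|kt ck].
    by rewrite subrr !mul0r !addr0.
  have zA z : z \in `](k%:R * r), t[ -> z \in `]0, A[.
    move: tA; rewrite !in_itv/= => /andP[_ tA] /andP[kz zt].
    by rewrite (le_lt_trans tk0 kz) (lt_le_trans zt tA).
  have [c ck' phiE] := MVT kt (fun z zk => dphiE z (zA z zk)) ck.
  have -> : phi t - (v k + (t - k%:R * r) * s k) =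
      (phi (k%:R * r) - v k) + (t - k%:R * r) * (dphi c - s k).
    by rewrite -[phi t](subrK (phi (k%:R * r))) phiE; ring.
  rewrite (le_trans (ler_normD _ _))// lerD2l normrM ger0_norm ?subr_ge0 ?(ltW kt)//.
  rewrite ler_wpM2l ?subr_ge0 ?(ltW kt)// slope ?zA//.
  move: ck'; rewrite in_itv/= => /andP[kc ct].
  by rewrite ltW// (le_trans (ltW ct)).
(* Stability of the bound from [t] to [u]: 1 + L(u-t) <= exp(L(u-t)) carries the old error to time
   [u], and the new contribution (u-t) eta is covered because exp(Lu) >= 1. *)
have step (E t u : R) : 0 <= t -> t <= u -> E <= t * eta * expR (L * t) ->
    E + (u - t) * (L * E + eta) <= u * eta * expR (L * u).
  move=> t0 tu HE.
  have Lu : expR (L * u) = expR (L * t) * expR (L * (u - t)).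
    by rewrite -expRD; congr expR; ring.
  have -> : E + (u - t) * (L * E + eta) =
      E * (1 + L * (u - t)) + (u - t) * eta by ring.
  have -> : u * eta * expR (L * u) =
      t * eta * expR (L * t) * expR (L * (u - t))
      + (u - t) * eta * expR (L * u) by rewrite Lu; ring.
  have ut0 : 0 <= u - t by rewrite subr_ge0.
  have Lut : 1 + L * (u - t) <= expR (L * (u - t)) by exact: expR_ge1Dx.
  have Lut0 : 0 <= L * (u - t) by rewrite mulr_ge0.
  apply: lerD.
    apply: (@le_trans _ _ (t * eta * expR (L * t) * (1 + L * (u - t)))).
      by rewrite ler_wpM2r// addr_ge0.
    by rewrite ler_wpM2l// !mulr_ge0// expR_ge0.
  rewrite ler_peMr ?mulr_ge0//.
  by rewrite -[leLHS]expR0 ler_expR mulr_ge0// (le_trans t0).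
have node k : k%:R * r \in `[0, A] ->
    `|phi (k%:R * r) - v k| <= k%:R * r * eta * expR (L * (k%:R * r)).
  elim: k => [|k IH] kA; first by rewrite mul0r v0 subrr normr0 !mul0r.
  have kS : k%:R * r <= k.+1%:R * r by rewrite ler_pM2r// ler_nat.
  have kA' : k%:R * r \in `[0, A].
    move: kA; rewrite !in_itv/= => /andP[_ kA].
    by rewrite mulr_ge0 ?(ltW r0)//= (le_trans kS).
  have := cell k (k.+1%:R * r) kA; rewrite lexx kS => /(_ isT).
  have -> : v k + (k.+1%:R * r - k%:R * r) * s k = v k.+1.
    by rewrite vS -natr1; ring.
  move=> /le_trans; apply; apply: step => //; last exact: IH.
  by rewrite mulr_ge0// ltW.
move=> k t tA kt; rewrite (le_trans (cell _ _ tA kt))// step//.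
- by rewrite mulr_ge0// ltW.
- by case/andP: kt.
- apply: node; move: tA kt; rewrite !in_itv/= => /andP[_ tA] /andP[kt _].
  by rewrite mulr_ge0 ?(ltW r0)//= (le_trans kt).
Qed.

(** The weighted square D^2 exp(-2Lt) is nonincreasing; squaring avoids differentiating an absolute
    value. *)
Lemma gronwall_norm_le (R : realType) (D dD : R -> R) (L y : R) :
  0 <= y -> (forall t, is_derive t (1 : R) D (dD t)) ->
  (forall t, `|dD t| <= L * `|D t|) -> `|D y| <= expR (L * y) * `|D 0|.
Proof.
move=> y0 HD dDL.
pose E t := D t ^+ 2 * expR (- (2 * L * t)).
have dE (t : R) : is_derive t (1 : R) E
    (2 * expR (- (2 * L * t)) * (D t * dD t - L * D t ^+ 2)).
  have := HD t => ?.
  rewrite /E; apply: is_derive_eq.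
  rewrite /GRing.scale/=; ring.
have cE : {within `[0, y], continuous E}.
  apply: continuous_subspaceT => t.
  by apply/differentiable_continuous/derivable1_diffP; apply: ex_derive.
have {cE} : E y <= E 0.
  apply: (@ler0_derive1_le_cc R E 0 y _ _ cE y 0) => //;
    rewrite ?in_itv/= ?lexx ?y0// => t _.
  rewrite derive1E derive_val; apply: mulr_ge0_le0.
    by rewrite mulr_ge0// expR_ge0.
  rewrite subr_le0 (le_trans (ler_norm _))// normrM.
  by rewrite -[D t ^+ 2]real_normK ?num_real// expr2 mulrCA ler_wpM2l.
rewrite /E mulr0 oppr0 expR0 mulr1 expRN ler_pdivrMr ?expR_gt0//.
have -> : expR (2 * L * y) = expR (L * y) ^+ 2.
  by rewrite -expRM_natl -mulrA.
rewrite -exprMn -[D y ^+ 2]real_normK ?num_real// -[(D 0 * _) ^+ 2]real_normK ?num_real//.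
by rewrite ler_pXn2r ?nnegrE// normrM mulrC (gtr0_norm (expR_gt0 _)).
Qed.

(** * Estimates for integrals over oriented segments *)

Lemma within_continuous_integrable (R : realType) (u : R -> R) (a b : R) :
  {within `[a, b], continuous u} ->
  lebesgue_measure.-integrable `[a, b] (EFin \o u).
Proof.
by move=> cu; apply: continuous_compact_integrable => //; exact: segment_compact.
Qed.

Lemma Rintegral_segment_cst (R : realType) (a b c : R) : a <= b ->
  \int[lebesgue_measure]_(x in `[a, b]) c = (b - a) * c.
Proof.
move=> ab; rewrite Rintegral_cst//.
rewrite [X in fine X](lebesgue_measure_itv `[a, b])/= lte_fin mulrC.
case: ltP => //= ba.
by rewrite (@le_anti _ _ a b) ?ab// subrr !mul0r.
Qed.

Lemma Rintegral_segment_dist (R : realType) (u v : R -> R) (a b e : R) :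
  a <= b -> {within `[a, b], continuous u} -> {within `[a, b], continuous v} ->
  (forall t, t \in `[a, b] -> `|u t - v t| <= e) ->
  `|\int[lebesgue_measure]_(x in `[a, b]) u x
    - \int[lebesgue_measure]_(x in `[a, b]) v x| <= (b - a) * e.
Proof.
move=> ab cu cv uv.
have iu := within_continuous_integrable cu.
have iv := within_continuous_integrable cv.
rewrite -RintegralB// -Rintegral_segment_cst//.
have iuv : lebesgue_measure.-integrable `[a, b] (EFin \o (u \- v)).
  apply: within_continuous_integrable => t.
  by apply: continuousB; [exact: cu|exact: cv].
rewrite (le_trans (le_normr_Rintegral _ iuv))// le_Rintegral//.
- exact: integrable_norm iuv.
- apply: within_continuous_integrable; apply: continuous_subspaceT => ?.
  exact: cvg_cst.
Qed.

Lemma Rintegral_segment_bound (R : realType) (u : R -> R) (a b K : R) :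
  a <= b -> {within `[a, b], continuous u} ->
  (forall t, t \in `[a, b] -> `|u t| <= K) ->
  `|\int[lebesgue_measure]_(x in `[a, b]) u x| <= (b - a) * K.
Proof.
move=> ab cu uK.
have := @Rintegral_segment_dist R u (cst 0) a b K ab cu.
rewrite /= Rintegral_segment_cst// mulr0 subr0; apply.
  by apply: continuous_subspaceT => ?; exact: cvg_cst.
by move=> t; rewrite subr0; exact: uK.
Qed.

Lemma Rintegral_segment_split (R : realType) (u : R -> R) (a b c : R) :
  a <= b -> b <= c -> {within `[a, c], continuous u} ->
  \int[lebesgue_measure]_(x in `[a, c]) u x =
  \int[lebesgue_measure]_(x in `[a, b]) u x
  + \int[lebesgue_measure]_(x in `[b, c]) u x.
Proof.
move=> ab bc cu; have iu := within_continuous_integrable cu.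
have /(_ _ _)/eqP := @Rintegral_itvB R u (BLeft a) (BRight c) b iu.
rewrite !bnd_simp => /(_ ab bc).
rewrite subr_eq => /eqP ->; rewrite addrC Rintegral_itv_obnd_cbnd//.
apply: (integrableS _ _ _ iu) => //.
by apply: subset_itvr; rewrite bnd_simp.
Qed.

Lemma subset_segment_center (R : realType) (y M : R) : `|y| <= M ->
  (`[0, y] `<=` `[- M, M]) /\ (`[y, 0] `<=` `[- M, M]).
Proof.
move=> yM; have M0 : 0 <= M by rewrite (le_trans _ yM).
move: yM; rewrite ler_norml => /andP[My yM].
by split; apply: subset_itv; rewrite bnd_simp// oppr_le0.
Qed.

(** Continuity on the symmetric segment covers both signs of [y] with one hypothesis. *)
Lemma oriented_integral_dist (R : realType) (u v : R -> R) (y M e : R) :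
  {within `[- M, M], continuous u} -> {within `[- M, M], continuous v} ->
  `|y| <= M -> (forall t, `|t| <= M -> `|u t - v t| <= e) ->
  `|oriented_integral 0 y u - oriented_integral 0 y v| <= `|y| * e.
Proof.
move=> cu cv yM uv; have [s1 s2] := subset_segment_center yM.
rewrite /oriented_integral; case: (leP 0 y) => [y0|/ltW y0].
  rewrite (ger0_norm y0) -[X in _ <= X * e]subr0; apply: Rintegral_segment_dist => //.
  - exact: continuous_subspaceW cu.
  - exact: continuous_subspaceW cv.
  - by move=> t /s1; rewrite /= in_itv/= -ler_norml; exact: uv.
rewrite -opprD normrN (ler0_norm y0) -[X in _ <= X * e]sub0r.
apply: Rintegral_segment_dist => //.
- exact: continuous_subspaceW cu.
- exact: continuous_subspaceW cv.
- by move=> t /s2; rewrite /= in_itv/= -ler_norml; exact: uv.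
Qed.

Lemma oriented_integral_bound (R : realType) (u : R -> R) (y M K : R) :
  {within `[- M, M], continuous u} -> `|y| <= M ->
  (forall t, `|t| <= M -> `|u t| <= K) -> `|oriented_integral 0 y u| <= `|y| * K.
Proof.
move=> cu yM uK; have [s1 s2] := subset_segment_center yM.
rewrite /oriented_integral; case: (leP 0 y) => [y0|/ltW y0].
  rewrite (ger0_norm y0) -[X in _ <= X * K]subr0; apply: Rintegral_segment_bound => //.
  - exact: continuous_subspaceW cu.
  - by move=> t /s1; rewrite /= in_itv/= -ler_norml; exact: uK.
rewrite normrN (ler0_norm y0) -[X in _ <= X * K]sub0r.
apply: Rintegral_segment_bound => //.
- exact: continuous_subspaceW cu.
- by move=> t /s2; rewrite /= in_itv/= -ler_norml; exact: uK.
Qed.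

Lemma oriented_integral_lipschitz (R : realType) (u : R -> R) (y z M K : R) :
  {within `[- M, M], continuous u} -> `|y| <= M -> `|z| <= M ->
  (forall t, `|t| <= M -> `|u t| <= K) ->
  `|oriented_integral 0 y u - oriented_integral 0 z u| <= K * `|y - z|.
Proof.
move=> cu.
wlog zy : y z / z <= y.
  move=> H yM zM uK; have [zy|/ltW yz] := leP z y; first exact: H.
  by rewrite distrC (distrC y) H.
move=> yM zM uK.
have M0 : 0 <= M by rewrite (le_trans _ yM).
have [s1 _] := subset_segment_center yM; have [_ s2] := subset_segment_center zM.
have zyM : `[z, y] `<=` `[- M, M].
  move: yM zM; rewrite !ler_norml => /andP[_ yM] /andP[zM _].
  by apply: subset_itv; rewrite bnd_simp.
have bzy : `|\int[lebesgue_measure]_(x in `[z, y]) u x| <= (y - z) * K.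
  apply: Rintegral_segment_bound => //; first exact: continuous_subspaceW cu.
  by move=> t /zyM; rewrite /= in_itv/= -ler_norml; exact: uK.
rewrite (ger0_norm (_ : 0 <= y - z)) ?subr_ge0// mulrC.
rewrite /oriented_integral; case: (leP 0 y) => [y0|y0]; case: (leP 0 z) => [z0|z0].
- rewrite (@Rintegral_segment_split _ u 0 z y)//; last exact: continuous_subspaceW cu.
  by rewrite addrC addrA addNr add0r.
- rewrite opprK addrC -Rintegral_segment_split// ?ltW//.
  exact: continuous_subspaceW cu.
- by have := le_lt_trans z0 (le_lt_trans zy y0); rewrite ltxx.
- rewrite (@Rintegral_segment_split _ u z y 0)// ?(ltW y0)//; last exact: continuous_subspaceW cu.
  by rewrite opprK addrCA addNr addr0.
Qed.

Lemma ler_dist_expR (R : realType) (A a b : R) : a <= A -> b <= A ->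
  `|expR a - expR b| <= expR A * `|a - b|.
Proof.
wlog ba : a b / b <= a.
  move=> H aA bA; have [zy|/ltW yz] := leP b a; first exact: H.
  by rewrite distrC (distrC a) H.
move=> aA bA; rewrite !ger0_norm ?subr_ge0 ?ler_expR//.
have -> : expR a - expR b = expR a * (1 - expR (b - a)).
  by rewrite mulrBr mulr1 -expRD; congr (_ - expR _); ring.
have := expR_ge1Dx (b - a) => H.
apply: (@le_trans _ _ (expR a * (a - b))).
  by rewrite ler_wpM2l ?expR_ge0//; lra.
by rewrite ler_wpM2r ?subr_ge0// ler_expR.
Qed.

(** [expR (- i) * b] is the shape of [doss_drift]: the two differences to control are those of the
    exponents and of the values of [b]. *)
Lemma exp_weight_dist (R : realType) (A B0 i1 i2 b1 b2 e1 e2 : R) :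
  `|i1| <= A -> `|i2| <= A -> `|b1| <= B0 ->
  `|i1 - i2| <= e1 -> `|b1 - b2| <= e2 ->
  `|expR (- i1) * b1 - expR (- i2) * b2| <= expR A * (B0 * e1 + e2).
Proof.
move=> i1A i2A b1B i12 b12.
have -> : expR (- i1) * b1 - expR (- i2) * b2 =
   (expR (- i1) - expR (- i2)) * b1 + expR (- i2) * (b1 - b2) by ring.
rewrite (le_trans (ler_normD _ _))// !normrM.
have i1A' : - i1 <= A by rewrite (le_trans (ler_norm _))// normrN.
have i2A' : - i2 <= A by rewrite (le_trans (ler_norm _))// normrN.
rewrite mulrDr lerD//.
  rewrite [B0 * _]mulrC mulrA ler_pM//.
  rewrite (le_trans (ler_dist_expR i1A' i2A'))// ler_wpM2l ?expR_ge0//.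
  by rewrite -opprD normrN.
by rewrite (gtr0_norm (expR_gt0 _)) ler_pM ?expR_ge0// ler_expR.
Qed.

(** * The flow and its Euler scheme *)

(** Reversing the second variable changes the sign of [sigma]. Together with [euler_h_opp], its
    counterpart for the scheme, this reduces estimates to [0 <= y]. *)
Lemma flow_opp (R : realType) (sigma : R -> R) h : flow sigma h ->
  flow (fun u => - sigma u) (fun x y => h x (- y)).
Proof.
move=> fh x; have [h0 dh] := fh x; split; first by rewrite oppr0.
move=> y; have := dh (- y) => dhy.
have -> : (fun y => h x (- y)) = h x \o -%R by [].
apply: is_derive_eq.
by rewrite /GRing.scale/= mulrN1.
Qed.

Lemma flow_lipschitz_time (R : realType) (sigma : R -> R) h (S : R) :
  flow sigma h -> (forall x, `|sigma x| <= S) ->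
  forall x y z, `|h x y - h x z| <= S * `|y - z|.
Proof.
move=> fh sS x y z; have [_ dh] := fh x.
wlog zy : y z / z <= y.
  by move=> H; have [/H//|/ltW/H] := leP z y; rewrite distrC (distrC z).
have ch : {within `[z, y], continuous (h x)}.
  apply: continuous_subspaceT => t.
  by apply/differentiable_continuous/derivable1_diffP; have := dh t => -[].
have [c _ ->] := MVT_segment zy (fun t _ => dh t) ch.
by rewrite normrM ler_wpM2r.
Qed.

Lemma flow_lipschitz_space (R : realType) (sigma : R -> R) h (S1 : R) :
  flow sigma h -> (forall x y, `|sigma x - sigma y| <= S1 * `|x - y|) ->
  forall x x' y, `|h x y - h x' y| <= expR (S1 * `|y|) * `|x - x'|.
Proof.
move=> + + x x' y.
wlog y0 : sigma h y / 0 <= y.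
  move=> H fh sS1; have [y0|/ltW y0] := leP 0 y; first exact: (H _ _ _ _ fh).
  have := H _ _ (- y) _ (flow_opp fh); rewrite normrN oppr_ge0 opprK; apply=> //.
  by move=> a b; rewrite -opprD normrN.
move=> fh sS1; have [hx dhx] := fh x; have [hx' dhx'] := fh x'.
rewrite (ger0_norm y0).
have := @gronwall_norm_le R (fun t => h x t - h x' t)
  (fun t => sigma (h x t) - sigma (h x' t)) S1 y y0.
by rewrite hx hx'; apply => t; exact: sS1.
Qed.

Lemma euler_h_opp (R : realType) (sigma : R -> R) n (x y : R) : 0 <= y ->
  euler_h sigma n x (- y) = euler_h (fun u => - sigma u) n x y.
Proof.
move=> y0.
have nodeN k : euler_h_node sigma (- n%:R^-1) x k =
    euler_h_node (fun u => - sigma u) n%:R^-1 x k.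
  by apply: eq_iter => u; rewrite mulNr mulrN.
rewrite /euler_h normrN y0; case: ifP => // _.
(* At [y = 0] both sides take the forward branch, with opposite slopes, and both equal [x]. *)
rewrite -nodeN; case: leP => [y0'|_]; last by rewrite mulrN opprK; ring.
have -> : y = 0 by apply/eqP; rewrite eq_le y0 -oppr_ge0 y0'.
by rewrite normr0 oppr0 mulr0 truncn0 /euler_h_node/= mul0r subr0 !mul0r.
Qed.

Lemma euler_h_cell (R : realType) (sigma : R -> R) n (x y : R) :
  (0 < n)%N -> `|x| <= n%:R -> 0 <= y <= n%:R ->
  exists2 k : nat, k%:R * n%:R^-1 <= y <= k.+1%:R * n%:R^-1 &
    euler_h sigma n x y = euler_h_node sigma n%:R^-1 x k
      + (y - k%:R * n%:R^-1) * sigma (euler_h_node sigma n%:R^-1 x k).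
Proof.
move=> n0 xn /andP[y0 yn]; have n0' : 0 < n%:R :> R by rewrite ltr0n.
rewrite /euler_h xn (ger0_norm y0) yn/= y0; eexists; last reflexivity.
have := truncn_itv (mulr_ge0 (ltW n0') y0).
by move=> /andP[k1 /ltW k2]; rewrite ler_pdivrMr// ler_pdivlMr// ![y * _]mulrC k1.
Qed.

Lemma euler_h_error_ge0 (R : realType) (sigma : R -> R) h (S S1 : R) n (x y : R) :
  flow sigma h -> 0 <= S1 -> (forall x, `|sigma x| <= S) ->
  (forall x y, `|sigma x - sigma y| <= S1 * `|x - y|) ->
  (0 < n)%N -> `|x| <= n%:R -> 0 <= y <= n%:R ->
  `|h x y - euler_h sigma n x y| <= y * (S1 * S / n%:R) * expR (S1 * y).
Proof.
move=> fh S10 sS sS1 n0 xn yn; have [k ky ->] := euler_h_cell sigma n0 xn yn.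
have S0 : 0 <= S by rewrite (le_trans _ (sS 0)).
have [hx dhx] := fh x.
have n0' : 0 < n%:R^-1 :> R by rewrite invr_gt0 ltr0n.
apply: (@euler_scheme_error R (h x) (fun t => sigma (h x t)) y n%:R^-1 S1
  (S1 * S / n%:R) (euler_h_node sigma n%:R^-1 x)
  (fun k => sigma (euler_h_node sigma n%:R^-1 x k))) => //.
- by rewrite !mulr_ge0// ltW.
- apply: continuous_subspaceT => t.
  by apply/differentiable_continuous/derivable1_diffP; have := dhx t => -[].
(* Within a cell [h x] moves by at most S/n, which is the origin of the slope error S1 * S / n. *)
- move=> j t _ /andP[jt tj]; rewrite (le_trans (sS1 _ _))// -mulrA -mulrDr.
  rewrite ler_wpM2l// (le_trans (ler_distD (h x (j%:R * n%:R^-1)) _ _))//.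
  rewrite [leLHS]addrC lerD2l.
  rewrite (le_trans (flow_lipschitz_time fh sS _ _ _))// ler_wpM2l//.
  rewrite ger0_norm ?subr_ge0//.
  by move: tj; rewrite -natr1 mulrDl mul1r lerBlDl addrC.
- by rewrite in_itv/= lexx andbT; case/andP: yn.
Qed.

Lemma euler_h_error (R : realType) (sigma : R -> R) h (S S1 M : R) n (x y : R) :
  flow sigma h -> 0 <= S1 -> (forall x, `|sigma x| <= S) ->
  (forall x y, `|sigma x - sigma y| <= S1 * `|x - y|) ->
  (0 < n)%N -> `|x| <= n%:R -> `|y| <= M -> M <= n%:R ->
  `|h x y - euler_h sigma n x y| <= M * S1 * S * expR (S1 * M) / n%:R.
Proof.
move=> fh S10 sS sS1 n0 xn yM Mn.
have S0 : 0 <= S by rewrite (le_trans _ (sS 0)).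
have n0' : 0 < n%:R^-1 :> R by rewrite invr_gt0 ltr0n.
apply: (@le_trans _ _ (`|y| * (S1 * S / n%:R) * expR (S1 * `|y|))); last first.
  have -> : M * S1 * S * expR (S1 * M) / n%:R =
     M * (S1 * S / n%:R) * expR (S1 * M) by ring.
  rewrite ler_pM ?expR_ge0 ?mulr_ge0 ?(ltW n0')//.
    by rewrite ler_wpM2r// !mulr_ge0// ltW.
  by rewrite ler_expR ler_wpM2l.
have yn := le_trans yM Mn.
have [y0|/ltW y0] := leP 0 y.
  by move: (yn); rewrite (ger0_norm y0) => ?; apply: euler_h_error_ge0; rewrite ?y0.
rewrite -{1 2}[y](opprK y) euler_h_opp ?oppr_ge0//.
move: (yn); rewrite (ler0_norm y0) => ?.
apply: (euler_h_error_ge0 (flow_opp fh)); rewrite ?oppr_ge0 ?y0//.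
  by move=> ?; rewrite normrN.
by move=> ? ?; rewrite -opprD normrN.
Qed.

(** Compares an interpolated value with a later node; the nodes in between are crossed by induction,
    each step costing at most S/n. This settles points of different cells in
    [euler_h_lipschitz_ge0]. *)
Lemma euler_h_node_dist (R : realType) (sigma : R -> R) (S : R) n (x y : R) k j :
  (forall x, `|sigma x| <= S) -> (0 < n)%N ->
  k%:R * n%:R^-1 <= y <= k.+1%:R * n%:R^-1 ->
  `|euler_h_node sigma n%:R^-1 x (k.+1 + j)
    - (euler_h_node sigma n%:R^-1 x k
       + (y - k%:R * n%:R^-1) * sigma (euler_h_node sigma n%:R^-1 x k))|
    <= S * ((k.+1 + j)%:R * n%:R^-1 - y).
Proof.
move=> sS n0 /andP[ky yk]; set v := euler_h_node _ _ _.
have n0' : 0 < n%:R^-1 :> R by rewrite invr_gt0 ltr0n.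
elim: j => [|j IH].
  have vS : v k.+1 = v k + n%:R^-1 * sigma (v k) by [].
  rewrite addn0 vS.
  have -> : v k + n%:R^-1 * sigma (v k) - (v k + (y - k%:R * n%:R^-1) * sigma (v k))
    = (k.+1%:R * n%:R^-1 - y) * sigma (v k) by rewrite -natr1; ring.
  by rewrite normrM ger0_norm ?subr_ge0// mulrC ler_wpM2r// subr_ge0.
rewrite addnS [v (_).+1]/(v (k.+1 + j)%N + n%:R^-1 * sigma (v (k.+1 + j)%N)).
rewrite addrAC (le_trans (ler_normD _ _))//.
have -> : S * ((k.+1 + j).+1%:R * n%:R^-1 - y) =
   S * ((k.+1 + j)%:R * n%:R^-1 - y) + n%:R^-1 * S.
  by rewrite -[(_.+1)%:R]natr1; ring.
by rewrite lerD// normrM (gtr0_norm n0') ler_pM2l.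
Qed.

Lemma euler_h_lipschitz_ge0 (R : realType) (sigma : R -> R) (S : R) n (x y z : R) :
  (forall x, `|sigma x| <= S) -> (0 < n)%N -> `|x| <= n%:R ->
  0 <= y <= n%:R -> 0 <= z <= n%:R ->
  `|euler_h sigma n x y - euler_h sigma n x z| <= S * `|y - z|.
Proof.
move=> sS n0 xn; wlog zy : y z / z <= y.
  by move=> H yn zn; have [/H->//|/ltW/H] := leP z y; rewrite distrC (distrC z); apply.
move=> yn zn; have S0 : 0 <= S by rewrite (le_trans _ (sS 0)).
have n0' : 0 < n%:R^-1 :> R by rewrite invr_gt0 ltr0n.
have [k kz ->] := euler_h_cell sigma n0 xn zn.
have [l ly ->] := euler_h_cell sigma n0 xn yn.
set v := euler_h_node _ _ _.
rewrite (ger0_norm (_ : 0 <= y - z)) ?subr_ge0//.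
have [kl|lk] := ltnP k l.
  have := @euler_h_node_dist R sigma S n x z k (l - k.+1)%N sS n0 kz.
  rewrite subnKC// -/v => H.
  rewrite [X in `|X|](_ : _ = (v l - (v k + (z - k%:R * n%:R^-1) * sigma (v k)))
    + (y - l%:R * n%:R^-1) * sigma (v l)); last by ring.
  apply: (le_trans (ler_normD _ _)).
  have -> : S * (y - z) = S * (l%:R * n%:R^-1 - z) + (y - l%:R * n%:R^-1) * S by ring.
  apply: lerD => //.
  rewrite normrM ger0_norm; last by rewrite subr_ge0; case/andP: ly.
  by rewrite ler_wpM2l// subr_ge0; case/andP: ly.
(* The cells given by [euler_h_cell] are closed, so [z <= y] with [l < k] happens only when [y = z]
   is their common node, where the two formulas agree. *)
have [lk'|kl] := ltnP l k.
  have yk : y <= k%:R * n%:R^-1.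
    case/andP: ly => _ /le_trans; apply.
    by rewrite ler_pM2r// ler_nat.
  have /eqP -> : y == z.
    by rewrite eq_le zy andbT (le_trans yk)//; case/andP: kz.
  have ek : k = l.+1.
    apply/eqP; rewrite eqn_leq lk' andbT.
    have : k%:R * n%:R^-1 <= l.+1%:R * n%:R^-1 :> R.
      by case/andP: kz => /le_trans + _; apply; rewrite (le_trans zy)//; case/andP: ly.
    by rewrite ler_pM2r// ler_nat.
  have zk : z = k%:R * n%:R^-1.
    by apply/eqP; rewrite eq_le (le_trans zy yk); case/andP: kz.
  have vS : v l.+1 = v l + n%:R^-1 * sigma (v l) by [].
  rewrite zk subrr mul0r ek vS -natr1.
  rewrite [X in `|X|](_ : _ = 0); last by ring.
  by rewrite normr0 mulr_ge0 ?subr_ge0 -?zk.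
have -> : l = k by apply/eqP; rewrite eqn_leq lk.
rewrite [X in `|X|](_ : _ = (y - z) * sigma (v k)); last by ring.
by rewrite normrM ger0_norm ?subr_ge0// [leRHS]mulrC ler_wpM2l// subr_ge0.
Qed.

(** Provides the continuity of the integrand sigma'(h^n(x, .)) in the drift of the scheme. Arguments
    of opposite signs are compared through [y = 0]. *)
Lemma euler_h_lipschitz_time (R : realType) (sigma : R -> R) (S : R) n (x y z : R) :
  (forall x, `|sigma x| <= S) -> (0 < n)%N -> `|x| <= n%:R ->
  `|y| <= n%:R -> `|z| <= n%:R ->
  `|euler_h sigma n x y - euler_h sigma n x z| <= S * `|y - z|.
Proof.
move=> + n0 xn.
have neg s u w : (forall x, `|s x| <= S) -> u <= 0 -> w <= 0 ->
    `|u| <= n%:R -> `|w| <= n%:R ->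
    `|euler_h s n x u - euler_h s n x w| <= S * `|u - w|.
  move=> sS u0 w0; rewrite (ler0_norm u0) (ler0_norm w0) => un wn.
  rewrite -[in euler_h s n x u](opprK u) -[in euler_h s n x w](opprK w).
  rewrite (@euler_h_opp _ _ _ _ (- u)) ?(@euler_h_opp _ _ _ _ (- w)) ?oppr_ge0//.
  have -> : u - w = - (- u - - w) by ring.
  rewrite normrN; apply: euler_h_lipschitz_ge0; rewrite ?oppr_ge0 ?u0 ?w0//.
  by move=> ?; rewrite normrN.
wlog zy : y z / z <= y.
  move=> H sS yn zn; have [/H->//|/ltW/H] := leP z y.
  by rewrite distrC (distrC z); apply.
move=> sS yn zn.
have [z0|/ltW z0] := leP 0 z.
  have y0 := le_trans z0 zy.
  move: yn zn; rewrite (ger0_norm y0) (ger0_norm z0) => yn zn.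
  by apply: euler_h_lipschitz_ge0; rewrite ?y0 ?z0.
have [y0|/ltW y0] := leP y 0; first exact: neg.
rewrite -[euler_h sigma n x y](subrK (euler_h sigma n x 0)) -addrA.
rewrite (le_trans (ler_normD _ _))//.
have -> : S * `|y - z| = S * `|y - 0| + S * `|0 - z|.
  by rewrite subr0 sub0r normrN (ler0_norm z0) (ger0_norm y0)
     (ger0_norm (_ : 0 <= y - z)) ?subr_ge0//; ring.
apply: lerD; last by apply: neg => //; rewrite normr0.
by apply: euler_h_lipschitz_ge0 => //; rewrite ?lexx ?ler0n// y0 -[y]ger0_norm.
Qed.

(** * The pathwise error bound *)

Lemma lipschitz_within_continuous (R : realType) (f : R -> R) (A : set R) (K : R) :
  0 <= K -> (forall x y, A x -> A y -> `|f x - f y| <= K * `|x - y|) ->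
  {within A, continuous f}.
Proof.
move=> K0 fK; apply/subspace_continuousP => x Ax.
apply/cvgrPdist_lt => e e0; rewrite near_withinE.
have d0 : 0 < e / (K + 1) by rewrite divr_gt0// ltr_wpDl.
near=> y => Ay; rewrite (le_lt_trans (fK x y Ax Ay))//.
rewrite (@le_lt_trans _ _ ((K + 1) * `|x - y|))//.
  by rewrite ler_wpM2r// lerDl.
rewrite mulrC -ltr_pdivlMr ?ltr_wpDl//.
Unshelve. all: by end_near. Qed.

(** * Bounds and Lipschitz estimates for the drift, exact or discretized *)

Section drift.
Context {R : realType} (b sigma : R -> R) (S1 S2 B0 B1 : R).
Hypothesis dsigma_bound : forall x, `|derive1 sigma x| <= S1.
Hypothesis dsigma_lip :
  forall x y, `|derive1 sigma x - derive1 sigma y| <= S2 * `|x - y|.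
Hypothesis b_bound : forall x, `|b x| <= B0.
Hypothesis b_lip : forall x y, `|b x - b y| <= B1 * `|x - y|.
Hypotheses (S20 : 0 <= S2) (B10 : 0 <= B1).
Implicit Types (h : R -> R -> R) (x y z M S : R).

Let S10 : 0 <= S1. Proof. exact: le_trans (dsigma_bound 0). Qed.

Let dsigma_continuous h x M S : 0 <= S ->
  (forall t s, `|t| <= M -> `|s| <= M -> `|h x t - h x s| <= S * `|t - s|) ->
  {within `[- M, M], continuous (fun u => derive1 sigma (h x u))}.
Proof.
move=> S0 hS; apply: (@lipschitz_within_continuous _ _ _ (S2 * S)).
  by rewrite mulr_ge0.
move=> t s /=; rewrite !in_itv/= -!ler_norml => tM sM.
by rewrite (le_trans (dsigma_lip _ _))// -mulrA ler_wpM2l// hS.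
Qed.

Let weight_bound h x y M S : 0 <= S ->
  (forall t s, `|t| <= M -> `|s| <= M -> `|h x t - h x s| <= S * `|t - s|) ->
  `|y| <= M ->
  `|oriented_integral 0 y (fun u => derive1 sigma (h x u))| <= M * S1.
Proof.
move=> S0 hS yM; have cs := dsigma_continuous S0 hS.
rewrite (le_trans (oriented_integral_bound cs yM (K := S1) _))//.
by rewrite ler_wpM2r.
Qed.

Lemma doss_drift_bound h x y M S : 0 <= S ->
  (forall t s, `|t| <= M -> `|s| <= M -> `|h x t - h x s| <= S * `|t - s|) ->
  `|y| <= M -> `|doss_drift b sigma h x y| <= expR (M * S1) * B0.
Proof.
move=> S0 hS yM; rewrite /doss_drift normrM (gtr0_norm (expR_gt0 _)).
rewrite ler_pM ?expR_ge0// ler_expR (le_trans (ler_norm _))// normrN.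
exact: weight_bound hS yM.
Qed.

(** With [h1 = h2] this is the Lipschitz estimate in [x]; with [x1 = x2] it is the distance between
    the exact and the discretized drift. *)
Lemma doss_drift_dist h1 h2 x1 x2 y M S e : 0 <= S ->
  (forall t s, `|t| <= M -> `|s| <= M -> `|h1 x1 t - h1 x1 s| <= S * `|t - s|) ->
  (forall t s, `|t| <= M -> `|s| <= M -> `|h2 x2 t - h2 x2 s| <= S * `|t - s|) ->
  `|y| <= M ->
  (forall t, `|t| <= M -> `|h1 x1 t - h2 x2 t| <= e) ->
  `|doss_drift b sigma h1 x1 y - doss_drift b sigma h2 x2 y|
    <= expR (M * S1) * (B0 * (M * S2) + B1) * e.
Proof.
move=> S0 h1S h2S yM he; rewrite /doss_drift.
have c1 := dsigma_continuous S0 h1S; have c2 := dsigma_continuous S0 h2S.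
have e0 : 0 <= e by rewrite (le_trans _ (he _ yM)).
have -> : expR (M * S1) * (B0 * (M * S2) + B1) * e =
  expR (M * S1) * (B0 * (M * (S2 * e)) + B1 * e) by ring.
apply: exp_weight_dist => //; first exact: weight_bound h1S yM.
- exact: weight_bound h2S yM.
- rewrite (le_trans (oriented_integral_dist c1 c2 yM (e := S2 * e) _))//.
    by move=> t tM; rewrite (le_trans (dsigma_lip _ _))// ler_wpM2l// he.
  by rewrite ler_wpM2r// mulr_ge0.
- by rewrite (le_trans (b_lip _ _))// ler_wpM2l// he.
Qed.

Lemma doss_drift_lipschitz_time h x y z M S : 0 <= S ->
  (forall t s, `|t| <= M -> `|s| <= M -> `|h x t - h x s| <= S * `|t - s|) ->
  `|y| <= M -> `|z| <= M ->
  `|doss_drift b sigma h x y - doss_drift b sigma h x z|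
    <= expR (M * S1) * (B0 * S1 + B1 * S) * `|y - z|.
Proof.
move=> S0 hS yM zM; rewrite /doss_drift.
have cs := dsigma_continuous S0 hS.
have -> : expR (M * S1) * (B0 * S1 + B1 * S) * `|y - z| =
  expR (M * S1) * (B0 * (S1 * `|y - z|) + B1 * (S * `|y - z|)) by ring.
apply: exp_weight_dist => //.
- exact: weight_bound hS yM.
- exact: weight_bound hS zM.
- exact: oriented_integral_lipschitz cs yM zM _.
- by rewrite (le_trans (b_lip _ _))// ler_wpM2l// hS.
Qed.

End drift.

(** The bound on the drift is available only for |x| <= N, so the size of the iterates and the right
    to use that bound are propagated by one induction. *)
Lemma euler_Y_node_bound (R : realType) (F : R -> R -> R) (Bn : R -> R) (T x0 FB N : R)
    m k :
  0 <= T -> 0 <= FB -> `|x0| + k%:R * (T / m%:R) * FB <= N ->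
  (forall x j, (j < k)%N -> `|x| <= N -> `|F x (Bn (j%:R * (T / m%:R)))| <= FB) ->
  `|euler_Y_node F Bn T m x0 k| <= `|x0| + k%:R * (T / m%:R) * FB.
Proof.
move=> T0 FB0; have r0 : 0 <= T / m%:R by rewrite divr_ge0.
elim: k => [|k IH] N0 HF; first by rewrite !mul0r addr0.
have kS : `|x0| + k.+1%:R * (T / m%:R) * FB =
    `|x0| + k%:R * (T / m%:R) * FB + T / m%:R * FB by rewrite -natr1; ring.
have kN : `|x0| + k%:R * (T / m%:R) * FB <= N.
  by rewrite (le_trans _ N0)// kS lerDl mulr_ge0.
have {}IH := IH kN (fun x j jk => HF x j (ltnW jk)).
rewrite kS /= (le_trans (ler_normD _ _))// lerD// normrM (ger0_norm r0).
by rewrite ler_wpM2l// HF// (le_trans IH).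
Qed.

Lemma norm_sum4_le (R : realDomainType) (a b c d A B C D E : R) :
  `|a| <= A -> `|b| <= B -> `|c| <= C -> `|d| <= D -> A + B + D <= E ->
  `|a + b + c + d| <= C + E.
Proof.
move=> aA bB cC dD ABE.
rewrite (le_trans (ler_normD _ _))// (le_trans (lerD (ler_normD _ _) dD))//.
rewrite (le_trans (lerD (lerD (ler_normD _ _) cC) (lexx _)))//.
by rewrite (le_trans (lerD (lerD (lerD aA bB) (lexx _)) (lexx _)))//; lra.
Qed.

(** The deterministic core: [g] and [gn] stand for one path of B^H and of B^n. [K] and [N] are fixed
    before [n], [gn] and [e], hence depend on the limiting path only. *)
Lemma sde_euler_pathwise (R : realType) (T x0 M : R) (b sigma : R -> R)
    (h : R -> R -> R) (g Y : R -> R) :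
  0 < T -> C_b 1 b -> C_b 2 sigma -> flow sigma h ->
  (forall t, t \in `[0, T] -> `|g t| <= M) ->
  {within `[0, T], continuous Y} -> Y 0 = x0 ->
  (forall t, t \in `]0, T[ ->
     is_derive t (1 : R) Y (doss_drift b sigma h (Y t) (g t))) ->
  exists2 K : R, 0 <= K & exists N : nat, forall n (gn : R -> R) e,
    (N <= n)%N -> e <= 1 ->
    (forall t, t \in `[0, T] -> `|g t - gn t| <= e) ->
    (forall s t, s \in `[0, T] -> t \in `[0, T] ->
       `|s - t| <= T / (n ^ 2)%:R -> `|g s - g t| <= e) ->
    forall t, t \in `[0, T] ->
      `|h (Y t) (g t)
        - euler_h sigma n
            (euler_Y (doss_drift b sigma (euler_h sigma n)) gn T (n ^ 2) x0 t)
            (gn t)| <= K * (e + n%:R^-1).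
Proof.
move=> T0 Cb Cs fh gM cY Y0 dY.
have [S S0 sS] := C_b_bounded Cs.
have [Sl Sl0 sSl] := C_bS_lipschitz Cs.
have [Sb Sb0 sSb] := C_b_bounded (C_bS_derive Cs).
have [S2 S20 dsS2] := C_bS_lipschitz (C_bS_derive Cs).
have [B0 B00 bB0] := C_b_bounded Cb.
have [B1 B10 bB1] := C_bS_lipschitz Cb.
(* A single constant serves as Lipschitz constant of [sigma] and as bound of its derivative. *)
pose S1 := Sl + Sb.
have S10 : 0 <= S1 by rewrite addr_ge0.
have sS1 x y : `|sigma x - sigma y| <= S1 * `|x - y|.
  by rewrite (le_trans (sSl _ _))// ler_wpM2r// lerDl.
have dsS1 x : `|derive1 sigma x| <= S1 by rewrite (le_trans (sSb _))// lerDr.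
have M0 : 0 <= M by rewrite (le_trans _ (gM 0 _))// in_itv/= lexx ltW.
(* Since [e <= 1], the path [gn] stays within distance 1 of [g], so both take values in
   [-M1, M1]. *)
pose M1 := M + 1.
have M10 : 0 <= M1 by rewrite addr_ge0.
have MM1 : M <= M1 by rewrite lerDl.
pose F := doss_drift b sigma h.
pose FB := expR (M1 * S1) * B0.
have FB0 : 0 <= FB by rewrite mulr_ge0// expR_ge0.
pose D := expR (M1 * S1) * (B0 * (M1 * S2) + B1).
have D0 : 0 <= D by rewrite mulr_ge0 ?expR_ge0// addr_ge0 ?mulr_ge0.
pose Lx := D * expR (S1 * M1).
have Lx0 : 0 <= Lx by rewrite mulr_ge0// expR_ge0.
pose Ly := expR (M1 * S1) * (B0 * S1 + B1 * S).
have Ly0 : 0 <= Ly by rewrite mulr_ge0 ?expR_ge0// addr_ge0 ?mulr_ge0.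
pose KH := M1 * S1 * S * expR (S1 * M1).
have KH0 : 0 <= KH by rewrite !mulr_ge0 ?expR_ge0.
(* The summands come from the displacement of [Y] over one cell, the error on the driving path, and
   the distance from [F] to [F^n]. *)
pose K' := Lx * FB * T + 2 * Ly + D * KH.
have T0' := ltW T0.
have LxFB0 : 0 <= Lx * FB by exact: mulr_ge0.
have K'0 : 0 <= K'.
  apply: addr_ge0; last exact: mulr_ge0.
  by apply: addr_ge0; apply: mulr_ge0.
have hS x t s : `|t| <= M1 -> `|s| <= M1 -> `|h x t - h x s| <= S * `|t - s|.
  by move=> _ _; exact: flow_lipschitz_time fh sS x t s.
have FFB x y : `|y| <= M1 -> `|F x y| <= FB.
  by move=> yM; exact: (doss_drift_bound dsS1 dsS2 bB0 S20 S0 (hS x)).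
have FLy x y z : `|y| <= M1 -> `|z| <= M1 -> `|F x y - F x z| <= Ly * `|y - z|.
  exact: (doss_drift_lipschitz_time dsS1 dsS2 bB0 bB1 S20 B10 S0 (hS x)).
have hLx x x' y : `|y| <= M1 -> `|h x y - h x' y| <= expR (S1 * M1) * `|x - x'|.
  move=> yM; rewrite (le_trans (flow_lipschitz_space fh sS1 _ _ _))// ler_wpM2r//.
  by rewrite ler_expR ler_wpM2l.
have FLx x x' y : `|y| <= M1 -> `|F x y - F x' y| <= Lx * `|x - x'|.
  move=> yM; rewrite /Lx -mulrA.
  apply: (doss_drift_dist dsS1 dsS2 bB0 bB1 S20 B10 S0 (hS x) (hS x')) => // t tM.
  exact: hLx.
have YL s t : s \in `[0, T] -> t \in `[0, T] -> s <= t -> `|Y t - Y s| <= FB * (t - s).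
  rewrite !in_itv/= => /andP[s0 _] /andP[_ tT] st.
  have cYs : {within `[s, t], continuous Y}.
    by apply: continuous_subspaceW cY; apply: subset_itv; rewrite bnd_simp.
  move: st; rewrite le_eqVlt => /predU1P[->|st]; first by rewrite !subrr normr0 mulr0.
  have sub z : z \in `]s, t[ -> z \in `]0, T[.
    rewrite !in_itv/= => /andP[sz zt].
    by rewrite (le_lt_trans s0 sz) (lt_le_trans zt tT).
  have [c cst ->] := MVT st (fun z zst => dY z (sub z zst)) cYs.
  rewrite normrM (ger0_norm (_ : 0 <= t - s)) ?subr_ge0 ?(ltW st)//.
  rewrite ler_wpM2r ?subr_ge0 ?(ltW st)// FFB// (le_trans (gM c _))//.
  exact/subset_itv_oo_cc/sub.
pose K := expR (S1 * M1) * (T * K' * expR (Lx * T)) + S + KH.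
exists K.
  apply: addr_ge0 => //; apply: addr_ge0 => //.
  by apply: mulr_ge0; rewrite ?expR_ge0// mulr_ge0 ?expR_ge0// mulr_ge0.
(* Beyond this rank the Euler path, bounded by |x0| + T * FB, and the driving paths, bounded by
   [M1], stay in the square where [h^n] is not cut off. *)
pose N := (Num.truncn (`|x0| + T * FB + M1)).+1.
have NX : `|x0| + T * FB + M1 <= N%:R by exact/ltW/truncnS_gt.
exists N => n gn e Nn e1 ggn gosc.
have n0 : (0 < n)%N by exact: leq_trans Nn.
have n0' : 0 < n%:R :> R by rewrite ltr0n.
have nX : `|x0| + T * FB + M1 <= n%:R by rewrite (le_trans NX)// ler_nat.
have M1n : M1 <= n%:R.
  by rewrite (le_trans _ nX)// lerDr addr_ge0// mulr_ge0// ltW.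
have xTn : `|x0| + T * FB <= n%:R by rewrite (le_trans _ nX)// lerDl.
have e0 : 0 <= e by rewrite (le_trans _ (ggn 0 _))// in_itv/= lexx ltW.
have gnM t : t \in `[0, T] -> `|gn t| <= M1.
  move=> tT; rewrite -[gn t](subrK (g t)) (le_trans (ler_normD _ _))// addrC lerD ?gM//.
  by rewrite distrC (le_trans (ggn t tT)).
pose hn := euler_h sigma n.
pose Fn := doss_drift b sigma hn.
have hnS x t s : `|x| <= n%:R -> `|t| <= M1 -> `|s| <= M1 ->
    `|hn x t - hn x s| <= S * `|t - s|.
  by move=> xn tM sM; apply: euler_h_lipschitz_time => //; apply: le_trans M1n.
have hhn x y : `|x| <= n%:R -> `|y| <= M1 -> `|h x y - hn x y| <= KH / n%:R.
  by move=> xn yM; exact: euler_h_error.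
have FnFB x y : `|x| <= n%:R -> `|y| <= M1 -> `|Fn x y| <= FB.
  move=> xn yM.
  by apply: (doss_drift_bound dsS1 dsS2 bB0 S20 S0 _ yM) => t s tM sM; exact: hnS.
have FFn x y : `|x| <= n%:R -> `|y| <= M1 -> `|F x y - Fn x y| <= D * (KH / n%:R).
  move=> xn yM.
  apply: (doss_drift_dist dsS1 dsS2 bB0 bB1 S20 B10 S0 (hS x) _ yM) => [t s tM sM|t tM].
    exact: hnS.
  exact: hhn.
set m := (n ^ 2)%N; have m0 : (0 < m)%N by rewrite expn_gt0 n0.
have m0' : 0 < m%:R :> R by rewrite ltr0n.
set r := T / m%:R; have r0 : 0 < r by rewrite divr_gt0.
have rT : m%:R * r = T by rewrite /r mulrC divfK// gt_eqF.
have rTn : r <= T / n%:R.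
  rewrite /r ler_pM2l// lef_pV2 ?posrE// ler_nat /m expnS expn1.
  by rewrite leq_pmulr.
pose v k := euler_Y_node Fn gn T m x0 k.
have kT k t : k%:R * r <= t -> t \in `[0, T] -> k%:R * r \in `[0, T].
  rewrite !in_itv/= => kt /andP[_ tT].
  by rewrite mulr_ge0 ?(ltW r0)//= (le_trans kt).
have vB k : k%:R * r \in `[0, T] -> `|v k| <= `|x0| + k%:R * r * FB.
  move=> kT'; have kTT : k%:R * r <= T by move: kT'; rewrite in_itv/= => /andP[].
  apply: (@euler_Y_node_bound _ _ _ _ _ _ n%:R) => //.
    by rewrite (le_trans _ xTn)// lerD2l ler_wpM2r.
  move=> x j jk xn; apply: FnFB => //; apply: gnM.
  apply: (kT _ _ _ kT'); rewrite ler_wpM2r ?(ltW r0)// ler_nat; exact: ltnW.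
have vn k : k%:R * r \in `[0, T] -> `|v k| <= n%:R.
  move=> kT'; rewrite (le_trans (vB k kT'))// (le_trans _ xTn)// lerD2l ler_wpM2r//.
  by move: kT'; rewrite in_itv/= => /andP[].
pose eta := K' * (e + n%:R^-1).
have eta0 : 0 <= eta by rewrite mulr_ge0// addr_ge0// invr_ge0 ltW.
have slope k t : t \in `]0, T[ -> k%:R * r <= t <= k.+1%:R * r ->
    `|F (Y t) (g t) - Fn (v k) (gn (k%:R * r))| <=
    Lx * `|Y (k%:R * r) - v k| + eta.
  move=> /subset_itv_oo_cc tT /andP[kt tk].
  have kT' := kT _ _ kt tT; set u := k%:R * r in kt kT' *.
  have tur : t - u <= r.
    by move: tk; rewrite -natr1 mulrDl mul1r -/u lerBlDl.
  have gtM : `|g t| <= M1 by rewrite (le_trans (gM _ tT)).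
  have guM : `|g u| <= M1 by rewrite (le_trans (gM _ kT')).
  have gnuM := gnM _ kT'.
  (* The intermediate points are chosen so that the passage from [Y u] to [v k] is made in the exact
     [F]; [Fn] is met only against [F] at the same point. *)
  have -> : F (Y t) (g t) - Fn (v k) (gn u) =
      (F (Y t) (g t) - F (Y u) (g t)) + (F (Y u) (g t) - F (Y u) (gn u))
    + (F (Y u) (gn u) - F (v k) (gn u)) + (F (v k) (gn u) - Fn (v k) (gn u)) by ring.
  have E1 : `|F (Y t) (g t) - F (Y u) (g t)| <= Lx * FB * T * n%:R^-1.
    have -> : Lx * FB * T * n%:R^-1 = Lx * (FB * (T / n%:R)) by ring.
    rewrite (le_trans (FLx _ _ _ gtM))// ler_wpM2l//.
    rewrite (le_trans (YL u t kT' tT kt))// ler_wpM2l//.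
    exact: le_trans rTn.
  have E2 : `|F (Y u) (g t) - F (Y u) (gn u)| <= 2 * Ly * e.
    have -> : 2 * Ly * e = Ly * (2 * e) by ring.
    rewrite (le_trans (FLy _ _ _ gtM gnuM))// ler_wpM2l//.
    rewrite (le_trans (ler_distD (g u) _ _))// mulr_natl mulr2n lerD ?ggn//.
    by apply: gosc => //; rewrite ger0_norm ?subr_ge0.
  have E3 := FLx (Y u) (v k) _ gnuM.
  have E4 := FFn (v k) (gn u) (vn k kT') gnuM.
  have ninv : 0 <= n%:R^-1 :> R by rewrite invr_ge0 ltW.
  have : Lx * FB * T * n%:R^-1 + 2 * Ly * e + D * (KH / n%:R) <= eta.
    have -> : eta = Lx * FB * T * n%:R^-1 + 2 * Ly * e + D * (KH / n%:R) +
       (Lx * FB * T * e + 2 * Ly * n%:R^-1 + D * KH * e) by rewrite /eta /K'; ring.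
    have P1 : 0 <= Lx * FB * T * e by apply: mulr_ge0 => //; exact: mulr_ge0.
    have P2 : 0 <= 2 * Ly * n%:R^-1 by apply: mulr_ge0 => //; exact: mulr_ge0.
    have P3 : 0 <= D * KH * e by apply: mulr_ge0 => //; exact: mulr_ge0.
    by rewrite lerDl; apply: addr_ge0 => //; exact: addr_ge0.
  apply: norm_sum4_le E1 E2 E3 E4.
have err := @euler_scheme_error R Y (fun t => F (Y t) (g t)) T r Lx eta v
  (fun k => Fn (v k) (gn (k%:R * r))) r0 Lx0 eta0 dY cY (esym Y0)
  (fun k => erefl) slope.
move=> t tT.
have /andP[t0 tT'] : 0 <= t <= T by move: tT; rewrite in_itv.
pose k := Num.truncn (t / r).
have kt : k%:R * r <= t <= k.+1%:R * r.
  have /andP[k1 /ltW k2] := truncn_itv (divr_ge0 t0 (ltW r0)).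
  by rewrite -ler_pdivlMr// k1 -ler_pdivrMr.
pose Yn := euler_Y Fn gn T m x0 t.
have YnE : Yn = v k + (t - k%:R * r) * Fn (v k) (gn (k%:R * r)) by [].
have YYn : `|Y t - Yn| <= T * eta * expR (Lx * T).
  rewrite YnE (le_trans (err k t tT kt))//; apply: ler_pM.
  - exact: mulr_ge0.
  - exact: expR_ge0.
  - exact: ler_wpM2r.
  - by rewrite ler_expR ler_wpM2l.
have kT' : k%:R * r \in `[0, T] by apply: (kT _ t) => //; case/andP: kt.
have Ynn : `|Yn| <= n%:R.
  rewrite (le_trans _ xTn)// YnE (le_trans (ler_normD _ _))//.
  apply: (@le_trans _ _ (`|x0| + k%:R * r * FB + (t - k%:R * r) * FB)).
    rewrite lerD ?vB// normrM ger0_norm; last by rewrite subr_ge0; case/andP: kt.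
    rewrite ler_wpM2l ?subr_ge0//; first by case/andP: kt.
    by apply: FnFB; [exact: vn|exact: gnM].
  by rewrite -addrA -mulrDl subrKC lerD2l ler_wpM2r.
rewrite -/m -/hn -/Fn -/Yn.
have gtM : `|g t| <= M1 by rewrite (le_trans (gM _ tT)).
have gntM := gnM _ tT.
have -> : h (Y t) (g t) - hn Yn (gn t) = (h (Y t) (g t) - h Yn (g t))
   + (h Yn (g t) - h Yn (gn t)) + (h Yn (gn t) - hn Yn (gn t)) by ring.
rewrite (le_trans (ler_normD _ _))// /K mulrDl mulrDl.
rewrite lerD//; last first.
  by rewrite (le_trans (hhn _ _ Ynn gntM))// ler_wpM2l// lerDr.
rewrite (le_trans (ler_normD _ _))// lerD//.
  rewrite (le_trans (hLx _ _ _ gtM))// -mulrA ler_wpM2l ?expR_ge0//.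
  rewrite (le_trans YYn)// /eta.
  by rewrite (_ : _ * _ * expR _ = T * K' * expR (Lx * T) * (e + n%:R^-1)); last by ring.
rewrite (le_trans (hS _ _ _ gtM gntM))// ler_wpM2l//.
by rewrite (le_trans (ggn t tT))// lerDl invr_ge0 ltW.
Qed.

(** * Modulus of continuity of fractional Brownian motion *)

Section dyadic_chaining.
Context {R : realType} (g : R -> R) (T q : R) (J : nat).
Hypotheses (T0 : 0 < T) (q0 : 0 < q) (q1 : q < 1).
Hypothesis cg : {within `[0, T], continuous g}.
Hypothesis incr : forall j k, (J <= j)%N -> (k < 2 ^ j)%N ->
  `|g (k.+1%:R * (T / (2 ^ j)%:R)) - g (k%:R * (T / (2 ^ j)%:R))| <= q ^+ j.

Let idx j (t : R) := Num.truncn (t / (T / (2 ^ j)%:R)).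
(** The last point of the dyadic grid of level [j] at or before [t]; for [t = T] it is [T]
    itself. *)
Let pt j t := (idx j t)%:R * (T / (2 ^ j)%:R).

Let d0 j : 0 < T / (2 ^ j)%:R :> R.
Proof. by rewrite divr_gt0// ltr0n expn_gt0. Qed.

Let idx_itv j t : 0 <= t ->
  (idx j t)%:R * (T / (2 ^ j)%:R) <= t < (idx j t).+1%:R * (T / (2 ^ j)%:R).
Proof.
move=> t0; have := truncn_itv (divr_ge0 t0 (ltW (d0 j))).
by rewrite ler_pdivlMr// ltr_pdivrMr.
Qed.

Let idx_max j t : t \in `[0, T] -> (idx j t <= 2 ^ j)%N.
Proof.
rewrite in_itv/= => /andP[t0 tT]; have /andP[it _] := idx_itv j t0.
rewrite -(ler_nat R) -(ler_pM2r (d0 j)) (le_trans it)// (le_trans tT)//.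
by rewrite mulrC divfK// pnatr_eq0 -lt0n expn_gt0.
Qed.

Let grid_step j k t : (J <= j)%N -> (k <= idx j t <= k.+1)%N ->
  t \in `[0, T] -> `|g (pt j t) - g (k%:R * (T / (2 ^ j)%:R))| <= q ^+ j.
Proof.
move=> Jj /andP[]; rewrite leq_eqVlt => /predU1P[-> _ _|ki ik tT].
  by rewrite /pt subrr normr0 exprn_ge0// ltW.
have ik' : idx j t = k.+1 by apply/eqP; rewrite eqn_leq ik.
by rewrite /pt ik' incr// -ik'; exact: idx_max.
Qed.

(** At the next level the index i becomes 2i or 2i+1, so at most one increment of the finer grid
    separates the two points. *)
Let refine j t : (J <= j)%N -> t \in `[0, T] ->
  `|g (pt j.+1 t) - g (pt j t)| <= q ^+ j.+1.
Proof.
move=> Jj tT; have t0 : 0 <= t by move: tT; rewrite in_itv/= => /andP[].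
have half : T / (2 ^ j)%:R = 2 * (T / (2 ^ j.+1)%:R).
  by rewrite expnS natrM invfM; field; rewrite pnatr_eq0 -lt0n expn_gt0.
have -> : pt j t = (2 * idx j t)%:R * (T / (2 ^ j.+1)%:R).
  by rewrite /pt half natrM; ring.
apply: grid_step => //; first exact: leqW.
have /andP[a1 a2] := idx_itv j t0; have /andP[b1 b2] := idx_itv j.+1 t0.
rewrite half mulrA in a1; rewrite half mulrA in a2.
apply/andP; split; rewrite -ltnS -(ltr_nat R) -(ltr_pM2r (d0 j.+1)).
  by rewrite (le_lt_trans _ b2)// natrM [2 * _]mulrC.
rewrite (le_lt_trans b1)// (lt_le_trans a2)// ler_pM2r// -natrM ler_nat.
by rewrite mulSn mulnC.
Qed.

(** Telescoping over the levels. The factor [1 - q ^+ m] gives the exact partial geometric sum, so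
    the induction closes with an equality. *)
Lemma dyadic_chain j m t : (J <= j)%N -> t \in `[0, T] ->
  `|g (pt (j + m) t) - g (pt j t)| <= q / (1 - q) * q ^+ j * (1 - q ^+ m).
Proof.
move=> Jj tT; elim: m => [|m IH].
  by rewrite addn0 !subrr normr0 mulr0.
have -> : g (pt (j + m.+1) t) - g (pt j t) =
   (g (pt (j + m).+1 t) - g (pt (j + m) t)) + (g (pt (j + m) t) - g (pt j t)).
  by rewrite addnS; ring.
rewrite (le_trans (ler_normD _ _))//.
rewrite (le_trans (lerD (refine _ tT) IH))// ?(leq_trans Jj) ?leq_addr//.
rewrite le_eqVlt; apply/orP; left; apply/eqP.
rewrite exprS exprD [in RHS]exprS; field.
by rewrite subr_eq0 gt_eqF.
Qed.

Lemma dyadic_chain_lim j t : (J <= j)%N -> t \in `[0, T] ->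
  `|g t - g (pt j t)| <= q / (1 - q) * q ^+ j.
Proof.
move=> Jj tT; have /andP[t0 tT'] : 0 <= t <= T by move: tT; rewrite in_itv.
apply/ler_addgt0Pr => e e0.
have /subspace_continuousP/(_ t) := cg; rewrite /= => /(_ tT).
move=> /cvgrPdist_lt/(_ e e0); rewrite near_withinE => -[r /= r0 Hr].
have [m Tm] : exists m, T / (2 ^ (j + m))%:R < r.
  exists (Num.truncn (T / r)).+1; set m := _.+1.
  rewrite ltr_pdivrMr ?ltr0n ?expn_gt0// mulrC -ltr_pdivrMr//.
  rewrite (lt_le_trans (truncnS_gt _))// ler_nat.
  by rewrite (leq_trans (ltnW (ltn_expl _ (ltnSn 1))))// leq_exp2l// leq_addl.
have /andP[p1 p2] := idx_itv (j + m) t0.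
have dpt : `|t - pt (j + m) t| < r.
  rewrite (le_lt_trans _ Tm)// ger0_norm ?subr_ge0// lerBlDl.
  by rewrite (le_trans (ltW p2))// /pt -natr1 mulrDl mul1r.
have ptT : pt (j + m) t \in `[0, T].
  by rewrite in_itv/= mulr_ge0 ?(ltW (d0 _))//= (le_trans p1).
have := Hr _ dpt ptT => /ltW Hg.
rewrite (le_trans (ler_distD (g (pt (j + m) t)) _ _))// addrC lerD//.
rewrite (le_trans (dyadic_chain m Jj tT))// ler_piMr//.
  by rewrite mulr_ge0 ?exprn_ge0 ?divr_ge0 ?subr_ge0 ?(ltW q0) ?(ltW q1).
by rewrite gerBl exprn_ge0// ltW.
Qed.

(** At level [j] the indices of [s] and [t] differ by at most one; each point is joined to its grid
    point by chaining. *)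
Lemma dyadic_modulus j s t : (J <= j)%N -> s \in `[0, T] -> t \in `[0, T] ->
  `|s - t| <= T / (2 ^ j)%:R ->
  `|g s - g t| <= (2 * (q / (1 - q)) + 1) * q ^+ j.
Proof.
move=> Jj; wlog st : s t / s <= t.
  move=> H sT tT; have [st|/ltW ts] := leP s t; first exact: H.
  by rewrite distrC (distrC (g s)); exact: H.
move=> sT tT; rewrite distrC ger0_norm ?subr_ge0// => dst.
have s0 : 0 <= s by move: sT; rewrite in_itv/= => /andP[].
have t0 : 0 <= t by rewrite (le_trans s0).
have /andP[a1 a2] := idx_itv j s0; have /andP[b1 b2] := idx_itv j t0.
have step : `|g (pt j t) - g (pt j s)| <= q ^+ j.
  apply: grid_step => //.
  apply/andP; split; rewrite -ltnS -(ltr_nat R) -(ltr_pM2r (d0 j)).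
    by rewrite (le_lt_trans a1)// (le_lt_trans st).
  rewrite (le_lt_trans b1)// -[in ltRHS]natr1 mulrDl mul1r.
  by rewrite -(subrK s t) addrC ltr_leD.
have := dyadic_chain_lim Jj sT; have := dyadic_chain_lim Jj tT => Ht Hs.
rewrite (le_trans (ler_distD (g (pt j s)) _ _))//.
have -> : (2 * (q / (1 - q)) + 1) * q ^+ j =
  q / (1 - q) * q ^+ j + (q ^+ j + q / (1 - q) * q ^+ j) by ring.
rewrite lerD// distrC (le_trans (ler_distD (g (pt j t)) _ _))//.
by rewrite addrC lerD.
Qed.

End dyadic_chaining.

(** * Gaussian tails *)

(** Doubling the deviation halves the peak, whence the factor 2, and leaves the exponent 1/2 - 1/8 =
    3/8. The tail bound then only needs the total mass 1 of the wider density. *)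
Lemma normal_pdf_le_wide (R : realType) (m s a x : R) : s != 0 -> 0 <= a ->
  a <= `|x - m| ->
  normal_pdf m s x <=
    2 * expR (- (3 / 8 * (a ^+ 2 / s ^+ 2))) * normal_pdf m (2 * s) x.
Proof.
move=> s0 a0 ax; have s20 : 2 * s != 0 by rewrite mulf_neq0.
rewrite !normal_pdfE//.
have -> : normal_peak s = 2 * normal_peak (2 * s).
  rewrite /normal_peak.
  have -> : (2 * s) ^+ 2 * pi *+ 2 = 2 ^+ 2 * (s ^+ 2 * pi *+ 2) by ring.
  by rewrite sqrtrM ?exprn_ge0// sqrtr_sqr ger0_norm// invfM mulrA divff// mul1r.
set e := expR _.
have -> : 2 * e * (normal_peak (2 * s) * normal_fun m (2 * s) x) =
  2 * normal_peak (2 * s) * (e * normal_fun m (2 * s) x) by ring.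
rewrite ler_wpM2l ?mulr_ge0 ?normal_peak_ge0//.
rewrite /normal_fun -expRD ler_expR.
have -> : - (x - m) ^+ 2 / (s ^+ 2 *+ 2) =
  - (3 / 8 * ((x - m) ^+ 2 / s ^+ 2)) + - (x - m) ^+ 2 / ((2 * s) ^+ 2 *+ 2).
  by field.
rewrite lerD2r lerN2 ler_pM2l ?divr_gt0// ler_pM2r ?invr_gt0 ?exprn_even_gt0//.
by rewrite -[leRHS]real_normK ?num_real// ler_pXn2r ?nnegrE.
Qed.

Lemma measurable_norm_ge (R : realType) (m a : R) :
  measurable [set x : R | a <= `|x - m|].
Proof.
have -> : [set x : R | a <= `|x - m|] = (fun x : R => `|x - m|) @^-1` `[a, +oo[.
  by apply/seteqP; split => x /=; rewrite in_itv/= andbT.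
have mf : measurable_fun setT (fun x : R => `|x - m|).
  by apply: measurableT_comp => //; exact: measurable_funB.
by rewrite -[X in measurable X]setTI; exact: mf.
Qed.

Lemma normal_prob_tail (R : realType) (m s a : R) : s != 0 -> 0 <= a ->
  (normal_prob m s [set x | (a <= `|x - m|)%R]
    <= (2 * expR (- (3 / 8 * (a ^+ 2 / s ^+ 2))))%:E)%E.
Proof.
move=> s0 a0; set c := 2 * _; rewrite /normal_prob.
have c0 : 0 <= c by rewrite mulr_ge0// expR_ge0.
have mA := measurable_norm_ge m a.
apply: (@le_trans _ _
  (\int[lebesgue_measure]_(x in [set x | (a <= `|x - m|)%R]) (c%:E * (normal_pdf m (2 * s) x)%:E))%E).
  apply: ge0_le_integral => //=.
  - by move=> x _; rewrite lee_fin normal_pdf_ge0.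
  - by apply/measurable_EFinP/measurable_funTS; exact: measurable_normal_pdf.
  - apply: measurable_funTS; apply: emeasurable_funM => //.
    by apply/measurable_EFinP; exact: measurable_normal_pdf.
  - by move=> x ax; rewrite -EFinM lee_fin normal_pdf_le_wide.
rewrite ge0_integralZl//=; last 2 first.
- by apply/measurable_EFinP/measurable_funTS; exact: measurable_normal_pdf.
- by move=> x _; rewrite lee_fin normal_pdf_ge0.
rewrite -[leRHS]mule1; apply: lee_wpmul2l; first by rewrite lee_fin.
rewrite -(integral_normal_pdf m (2 * s)); apply: ge0_subset_integral => //.
- by apply/measurable_EFinP; exact: measurable_normal_pdf.
- by move=> x _; rewrite lee_fin normal_pdf_ge0.
Qed.

Lemma normal_prob_ball (R : realType) (m s a : R) : s != 0 -> 0 < a ->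
  (normal_prob m s `](- a)%R, a[ <= (2 * a * normal_peak s)%:E)%E.
Proof.
move=> s0 a0; rewrite /normal_prob.
apply: (@le_trans _ _ (\int[lebesgue_measure]_(x in `](- a)%R, a[) (normal_peak s)%:E)%E).
  apply: ge0_le_integral => //=.
  - by move=> x _; rewrite lee_fin normal_pdf_ge0.
  - by apply/measurable_EFinP/measurable_funTS; exact: measurable_normal_pdf.
  - by move=> x _; rewrite lee_fin normal_pdf_ub.
rewrite integral_cst// [X in (_ * X)%E](lebesgue_measure_itv `](- a), a[)/= lte_fin.
rewrite gtrN// -EFinB -EFinM lee_fin opprK mulrC.
by have -> : a + a = 2 * a by ring.
Qed.

Lemma normal_peak_scale (R : realType) (s : R) : 0 < s -> s * normal_peak s <= 2^-1.
Proof.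
move=> s0; rewrite /normal_peak -ler_pdivlMl// -invfM.
rewrite lef_pV2 ?posrE ?mulr_gt0// ?sqrtr_gt0 ?mulrn_wgt0 ?mulr_gt0 ?exprn_gt0 ?pi_gt0//.
rewrite -[leLHS]ger0_norm ?mulr_ge0 ?(ltW s0)// -sqrtr_sqr.
have := @pi_ge2 R => pi2.
apply: ler_wsqrtr; rewrite exprMn.
have : s ^+ 2 * 2 <= s ^+ 2 * pi by rewrite ler_wpM2l ?exprn_ge0 ?(ltW s0).
lra.
Qed.

Section gaussian_tail.
Context {R : realType} {d : measure_display} {Omega : measurableType d}.
Variables (P : probability Omega R) (V : {RV P >-> R}) (v : R).
Hypothesis v0 : 0 < v.
Hypothesis cheb : forall x, 0 < x ->
  (P [set w | (x <= `|V w|)%R] <= (v ^+ 2 / x ^+ 2)%:E)%E.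

Let preimage_tail m a :
  [set w | a <= `|V w - m|] = V @^-1` [set x | (a <= `|x - m|)%R].
Proof. by []. Qed.

Let measurable_tail m a : measurable [set w | a <= `|V w - m|].
Proof.
rewrite preimage_tail -[X in measurable X]setTI.
by apply: (measurable_funP V) => //; exact: measurable_norm_ge.
Qed.

(** The mean [m] and deviation [s] of the law are controlled through [cheb] alone: |s| <= 3v and |m|
    <= 14v. Hence 28 = 2 * 14, which makes [m] cost at most half of [lambda]; the exponent is then
    at least 3/8 * 1/4 * 1/9 = 1/96, in units of (lambda/v)^2, rounded to 1/100. *)
Lemma gaussian_tail lambda : gaussian_var P V -> 28 * v <= lambda ->
  (P [set w | (lambda <= `|V w|)%R]
    <= (2 * expR (- (lambda ^+ 2 / (100 * v ^+ 2))))%:E)%E.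
Proof.
move=> [m [s Vlaw]] hl.
have l0 : 0 < lambda by rewrite (lt_le_trans _ hl)// mulr_gt0.
have V0 a : [set w | a <= `|V w|] = [set w | a <= `|V w - 0|].
  by apply/seteqP; split => w /=; rewrite subr0.
have mt a : measurable [set w | a <= `|V w|] by rewrite V0.
have lawT a : P [set w | a <= `|V w|] =
    (if s == 0 then \d_m [set x | (a <= `|x|)%R] else normal_prob m s [set x | (a <= `|x|)%R]).
  rewrite -Vlaw//; have := measurable_norm_ge 0 a.
  by congr measurable; apply/seteqP; split => x /=; rewrite subr0.
have [s0|s0] := eqVneq s 0.
  (* Point mass at [m]: if |m| >= lambda the event would have probability 1, against Chebyshev's
     bound since v < lambda. *)
  have [lm|ml] := leP lambda `|m|.
    exfalso; have := cheb l0; rewrite lawT s0 eqxx diracE mem_set//=.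
    rewrite lee_fin leNgt => /negP; apply.
    rewrite ltr_pdivrMr ?exprn_gt0// mul1r ltr_pXn2r ?nnegrE ?(ltW v0) ?(ltW l0)//.
    by rewrite (lt_le_trans _ hl)// ltr_pMl// ltr1n.
  rewrite lawT s0 eqxx diracE memNset/=; last by apply/negP; rewrite -ltNge.
  by rewrite lee_fin mulr_ge0// expR_ge0.
pose S := `|s|; have S0 : 0 < S by rewrite normr_gt0.
have SE : S ^+ 2 = s ^+ 2 by rewrite real_normK ?num_real.
have peakS : normal_peak S = normal_peak s by rewrite /normal_peak SE.
have lawN A : measurable A -> P (V @^-1` A) = normal_prob m s A.
  by move=> mA; rewrite Vlaw// (negbTE s0).
(* The density is at most 1/(2S), so half of the mass lies outside ]-S/2, S/2[,
   and Chebyshev bounds S by the standard deviation. *)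
have Sv : S <= 3 * v.
  have Sh : 0 < S / 2 by rewrite divr_gt0.
  have mb : measurable (V @^-1` `]- (S / 2), S / 2[).
    by rewrite -[X in measurable X]setTI; exact: (measurable_funP V).
  have := cheb Sh.
  have -> : [set w | S / 2 <= `|V w|] = ~` (V @^-1` `]- (S / 2), S / 2[).
    apply/seteqP; split => w /=; rewrite in_itv/= -ltr_norml => H; first by apply/negP; rewrite -leNgt.
    by rewrite leNgt; exact/negP.
  rewrite probability_setC// => /(le_trans _) H.
  have : ((1 - 2^-1 : R)%:E <= (v ^+ 2 / (S / 2) ^+ 2)%:E)%E.
    apply: H; rewrite EFinB leeB//.
    rewrite lawN//; apply: (le_trans (normal_prob_ball m s0 Sh)).
    rewrite lee_fin mulrCA divff// mulr1 -peakS.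
    exact: normal_peak_scale.
  rewrite lee_fin ler_pdivlMr ?exprn_gt0// => H2.
  rewrite -(@ler_pXn2r _ 2) ?nnegrE ?mulr_ge0 ?(ltW S0) ?(ltW v0)//.
  have := sqr_ge0 v; have -> : (3 * v) ^+ 2 = 9 * v ^+ 2 by ring.
  have : (S / 2) ^+ 2 = S ^+ 2 / 4 by field.
  lra.
have tailN a : 0 <= a -> (P [set w | (a <= `|V w - m|)%R]
    <= (2 * expR (- (3 / 8 * (a ^+ 2 / s ^+ 2))))%:E)%E.
  move=> a0; rewrite preimage_tail lawN//; last exact: measurable_norm_ge.
  exact: normal_prob_tail.
(* If |m| > 14v, the events |V| < 2v and |V - m| < 4S <= 12v exclude each other. Their complements
   have probability at most 1/4 and 2 exp(-6) <= 2/7, which do not add up to 1. *)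
have m14 : `|m| <= 14 * v.
  rewrite leNgt; apply/negP => mv.
  have P1 : (P [set w | (2 * v <= `|V w|)%R] <= (4^-1)%:E)%E.
    apply: (le_trans (cheb _)); rewrite ?mulr_gt0// lee_fin.
    by rewrite exprMn invfM mulrCA divff ?mulr1 ?expf_neq0 ?gt_eqF// lef_pV2 ?posrE//; lra.
  have P2 : (P [set w | (4 * S <= `|V w - m|)%R] <= (2 / 7)%:E)%E.
    apply: (le_trans (tailN _ _)); rewrite ?mulr_ge0 ?(ltW S0)// lee_fin ler_pM2l//.
    have -> : 3 / 8 * ((4 * S) ^+ 2 / s ^+ 2) = 6 :> R.
      by rewrite exprMn SE; field.
    rewrite expRN lef_pV2 ?posrE ?expR_gt0//.
    by have := @expR_ge1Dx R 6; lra.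
  have : (P setT <= (4^-1 : R)%:E + (2 / 7 : R)%:E)%E.
    apply: le_trans (leeD P1 P2).
    apply: le_trans (measureU2 P _ _) => //.
    rewrite le_measure ?inE//; first exact: measurableU.
    move=> w _ /=; apply: contrapT => /not_orP[/negP + /negP].
    rewrite -!ltNge => V1 V2.
    have : `|m| <= `|V w| + `|V w - m|.
      have {1}-> : m = V w - (V w - m) by ring.
      exact: ler_normB.
    by lra.
  by rewrite probability_setT -EFinD lee_fin; lra.
have lh : 0 <= lambda / 2 by rewrite divr_ge0// ltW.
apply: (@le_trans _ _ (P [set w | (lambda / 2 <= `|V w - m|)%R])).
  rewrite le_measure ?inE// => w /= lV.
  have : `|V w| <= `|V w - m| + `|m|.
    by rewrite -{1}[V w](subrK m); exact: ler_normD.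
  by lra.
apply: (le_trans (tailN _ lh)); rewrite lee_fin ler_pM2l// ler_expR lerN2.
have -> : 3 / 8 * ((lambda / 2) ^+ 2 / s ^+ 2) = lambda ^+ 2 * (3 / 32 / s ^+ 2) by field.
rewrite ler_wpM2l ?sqr_ge0// -SE.
have S2v : S ^+ 2 <= 9 * v ^+ 2.
  have -> : 9 * v ^+ 2 = (3 * v) ^+ 2 by ring.
  by rewrite ler_pXn2r ?nnegrE ?mulr_ge0 ?(ltW S0) ?(ltW v0).
rewrite -[leLHS]mul1r ler_pdivrMr ?mulr_gt0 ?exprn_gt0//.
rewrite mulrAC ler_pdivlMr ?exprn_gt0//.
by have := sqr_ge0 v; lra.
Qed.

End gaussian_tail.

(** * Outer probability and Borel-Cantelli *)

Section outer_measure_null.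
Context {R : realType} {d : measure_display} {Omega : measurableType d}.
Variable P : probability Omega R.

Lemma le_outer_prob (A B : set Omega) : A `<=` B ->
  (outer_prob P A <= outer_prob P B)%E.
Proof. exact: le_mu_ext. Qed.

Lemma outer_prob_measurable (A : set Omega) : measurable A ->
  outer_prob P A = P A.
Proof. exact: measurable_mu_extE. Qed.

Lemma outer_prob_ge0 (A : set Omega) : (0 <= outer_prob P A)%E.
Proof. exact: mu_ext_ge0. Qed.

Lemma outer_prob_le1 (A : set Omega) : (outer_prob P A <= 1)%E.
Proof.
rewrite (le_trans (le_outer_prob (@subsetT _ A)))//.
by rewrite outer_prob_measurable// probability_setT.
Qed.

Lemma outer_prob_negligible (A : set Omega) : P.-negligible A ->
  outer_prob P A = 0%E.
Proof.
move=> [B [mB PB AB]]; apply/eqP; rewrite eq_le outer_prob_ge0 andbT.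
by rewrite (le_trans (le_outer_prob AB))// outer_prob_measurable// PB.
Qed.

Lemma outer_probU0 (A B : set Omega) : outer_prob P A = 0%E ->
  outer_prob P B = 0%E -> outer_prob P (A `|` B) = 0%E.
Proof.
move=> A0 B0; apply/eqP; rewrite eq_le outer_prob_ge0 andbT.
have U : (outer_prob P (A `|` B) <= outer_prob P A + outer_prob P B)%E.
  exact: outer_measureU2.
by rewrite (le_trans U)// A0 B0 adde0.
Qed.

(** Countable subadditivity bounds the limit superior by every tail of the convergent series, and
    the tails tend to 0; the sets [F n] may be non-measurable. *)
Lemma outer_borel_cantelli (F : (set Omega)^nat) (u : nat -> R) (N : nat) (C : R) :
  (forall n, 0 <= u n) -> (forall n, \sum_(0 <= k < n) u k <= C) ->
  (forall n, (N <= n)%N -> (outer_prob P (F n) <= (u n)%:E)%E) ->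
  outer_prob P (lim_sup_set F) = 0%E.
Proof.
move=> u0 uC Fu; apply/eqP; rewrite eq_le outer_prob_ge0 andbT.
have usum : (\sum_(0 <= k <oo) (u k)%:E < +oo)%E.
  apply: (@le_lt_trans _ _ C%:E); last by rewrite ltry.
  apply: lime_le; first by apply: is_cvg_nneseries => k _ _; rewrite lee_fin.
  by apply: nearW => n; rewrite sumEFin lee_fin.
have := @nneseries_tail_cvg R (fun k => (u k)%:E) xpredT usum (fun k _ => u0 k).
move=> tail; apply: (@cvge_ge _ _ _ _ _ _ _ _ tail).
near=> M.
have NM : (N <= M)%N by near: M; exists N.
(* The series are compared term by term at every index, so the sets of rank below [N], which carry
   no bound, are emptied. *)
pose G n := if (N <= n)%N then F n else set0.
apply: (@le_trans _ _ (outer_prob P (\bigcup_(n in ~` `I_M) G n))).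
  apply: le_outer_prob => w /(_ M Logic.I)[n /= Mn Fn]; exists n => /=.
    by apply/negP; rewrite -leqNgt.
  by rewrite /G (leq_trans NM).
apply: (le_trans (outer_measure_sigma_subadditive_tail (mu_ext P) M G)).
apply: lee_nneseries => [k _ _|k _]; first exact: outer_prob_ge0.
rewrite /G; case: ifPn => [/Fu//|_].
by rewrite outer_measure0 lee_fin.
Unshelve. all: by end_near. Qed.

End outer_measure_null.

(** Telescoping with 1/(x+1)^2 <= 1/x - 1/(x+1). The term of index 0 is 0, by the convention for
    [powR] at 0. *)
Lemma sum_inv_sqr_le (R : realType) n :
  \sum_(0 <= k < n) (k%:R : R) `^ (- 2) <= 2.
Proof.
have inv2 k : (k.+1%:R : R) `^ (- 2) = (k.+1%:R ^+ 2)^-1.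
  by rewrite powRN powR_mulrn.
have H m : \sum_(0 <= k < m.+2) (k%:R : R) `^ (- 2) <= 2 - m.+1%:R^-1.
  elim: m => [|m IH].
    rewrite !big_nat_recr//= big_geq// powR0 ?oppr_eq0 ?pnatr_eq0//.
    by rewrite inv2 expr1n invr1; lra.
  rewrite big_nat_recr//= (le_trans (lerD IH (lexx _)))// inv2.
  have step (x : R) : 0 < x -> 2 - x^-1 + ((x + 1) ^+ 2)^-1 <= 2 - (x + 1)^-1.
    move=> x0; rewrite -subr_ge0.
    have -> : 2 - (x + 1)^-1 - (2 - x^-1 + ((x + 1) ^+ 2)^-1) =
        (x * (x + 1) ^+ 2)^-1.
      by field; rewrite !gt_eqF// addr_gt0.
    by rewrite invr_ge0 mulr_ge0 ?sqr_ge0// ltW.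
  by rewrite -[m.+2%:R]natr1 step// ltr0n.
case: n => [|[|n]]; first by rewrite big_geq.
  by rewrite big_nat1 powR0 ?oppr_eq0 ?pnatr_eq0.
by rewrite (le_trans (H n))// gerBl.
Qed.

Lemma sum_geometric_half_le (R : realType) (K : R) n : 0 <= K ->
  \sum_(0 <= k < n) K * 2^-1 ^+ k <= 2 * K.
Proof.
move=> K0; suff -> : \sum_(0 <= k < n) K * 2^-1 ^+ k = 2 * K * (1 - 2^-1 ^+ n).
  by rewrite ler_piMr ?mulr_ge0// gerBl exprn_ge0.
elim: n => [|n IH]; first by rewrite big_geq// expr0 subrr mulr0.
by rewrite big_nat_recr//= IH exprS; field.
Qed.

(** * Increments of fractional Brownian motion *)

Section fbm_increments.
Context {R : realType} {d : measure_display} {Omega : measurableType d}.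
Variable P : probability Omega R.

Lemma integrable_sqr_Lfun2 (X : {RV P >-> R}) :
  (\int[P]_w ((X w) ^+ 2)%:E < +oo)%E -> (X : Omega -> R) \in Lfun P 2%:E.
Proof.
move=> X2; rewrite inE; apply/andP; split; first by rewrite inE/=; exact: measurable_funPT.
rewrite inE/= /finite_norm; apply: (@lty_poweRy _ _ 2) => //.
rewrite poweR_Lnorm//; under eq_integral do rewrite /= powR_mulrn// -normrX ger0_norm ?sqr_ge0//.
by [].
Qed.

Lemma fbm_increment_chebyshev (H T : R) (BH : R -> {RV P >-> R}) (s t x : R) :
  fractional_brownian H T BH -> s \in `[0, T] -> t \in `[0, T] -> 0 < x ->
  0 < H ->
  (P [set w | (x <= `|BH t w - BH s w|)%R]
    <= ((`|t - s| `^ H) ^+ 2 / x ^+ 2)%:E)%E.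
Proof.
move=> [_ E0 cov _] sT tT x0 H0.
have sqr u : u `^ (2 * H) = (u `^ H) ^+ 2.
  by rewrite mulrC powRrM powR_mulrn// powR_ge0.
have H20 : 2 * H != 0 by rewrite mulf_neq0// gt_eqF.
have L2 u : u \in `[0, T] -> (BH u : Omega -> R) \in Lfun P 2%:E.
  move=> uT; apply: integrable_sqr_Lfun2.
  (* Square integrability is read off the finite covariance of [BH u] with itself: the mean being 0,
     its integrand is the square of [BH u]. *)
  have cuu := cov u u uT uT; rewrite unlock E0//= unlock in cuu.
  rewrite (_ : (\int[P]_w _)%E = (2^-1 * (u `^ (2 * H) + u `^ (2 * H)
    - `|u - u| `^ (2 * H)))%:E) ?ltry// -cuu.
  apply: eq_integral => w _ /=.
  by rewrite [RHS](_ : _ = ((BH u w - 0) * (BH u w - 0))%:E)// subr0 expr2.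
have Pfin : P setT \is a fin_num := fin_num_measure P _ measurableT.
have L1 u (uT : u \in `[0, T]) := Lfun_subset12 Pfin (L2 u uT).
have := @chebyshev _ _ _ P (BH t \- BH s : {RV P >-> R}) x x0.
rewrite /= expectationB ?L1// !E0// sub0e oppe0/= => /le_trans.
rewrite (_ : [set w | _] = [set w | (x <= `|BH t w - BH s w|)%R]); last first.
  by apply/seteqP; split => w /=; rewrite subr0.
apply.
rewrite varianceB ?L2// /variance !cov//.
rewrite !subrr !normr0 !(powR0 H20) !subr0 -!(EFinD, EFinM, EFinN) lee_fin.
rewrite le_eqVlt; apply/orP; left; apply/eqP.
rewrite !sqr; field.
by rewrite gt_eqF.
Qed.

End fbm_increments.

(** Write exp(-x) as exp(x/p)^(-p) and use exp(y) >= y. The power [p] is free, and is later chosen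
    to beat the number of dyadic cells. *)
Lemma expRN_le_power (R : realType) (p : nat) (x : R) : (0 < p)%N -> 0 < x ->
  expR (- x) <= (p%:R / x) ^+ p.
Proof.
move=> p0 x0; have p0' : 0 < p%:R :> R by rewrite ltr0n.
have xE : x = p%:R * (x / p%:R) by field; rewrite gt_eqF.
rewrite {1}xE expRN expRM_natl -exprVn.
rewrite ler_pXn2r ?nnegrE ?invr_ge0 ?expR_ge0 ?divr_ge0 ?(ltW x0)//.
rewrite -[leRHS]invrK invf_div lef_pV2 ?posrE ?expR_gt0 ?divr_gt0//.
by rewrite (le_trans _ (expR_ge1Dx _))// lerDr.
Qed.

Lemma expr_eventually_le (R : realType) (r e : R) : 0 < r < 1 -> 0 < e ->
  exists N, forall n, (N <= n)%N -> r ^+ n <= e.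
Proof.
move=> /andP[r0 r1] e0.
have : (r ^+ n @[n --> \oo] --> 0)%classic by apply: cvg_expr; rewrite gtr0_norm.
move=> /cvgrPdist_lt/(_ e e0)[N _ HN]; exists N => n Nn.
have := HN n Nn; rewrite /= sub0r normrN => /ltW.
by rewrite ger0_norm// exprn_ge0// ltW.
Qed.

Lemma outer_prob_bigcup_le (R : realType) (d : measure_display)
    (Omega : measurableType d) (P : probability Omega R) (F : nat -> set Omega)
    (n : nat) (c : R) :
  (forall k, (k < n)%N -> (outer_prob P (F k) <= c%:E)%E) ->
  (outer_prob P [set w | exists2 k, (k < n)%N & F k w] <= (n%:R * c)%:E)%E.
Proof.
move=> Fc; apply: (@le_trans _ _ (outer_prob P (\big[setU/set0]_(i < n) F i))).
  apply: le_outer_prob => w [k kn Fk].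
  by rewrite -bigcup_mkord; exists k.
apply: le_trans (outer_measure_subadditive (mu_ext P) F n) _.
apply: le_trans (lee_sum _ (fun (i : 'I_n) _ => Fc i (ltn_ord i))) _.
by rewrite sumEFin sumr_const card_ord mulr_natl.
Qed.

Section fbm_modulus.
Context {R : realType} {d : measure_display} {Omega : measurableType d}.
Variables (P : probability Omega R) (H T gamma : R) (BH : R -> {RV P >-> R}).
Hypotheses (T0 : 0 < T) (gamma0 : 0 < gamma) (gammaH : gamma < H).
Hypothesis hBH : fractional_brownian H T BH.

Let q : R := 2^-1 `^ gamma.
Let grid j k : R := k%:R * (T / (2 ^ j)%:R).
Let jump j : set Omega := [set w | exists2 k, (k < 2 ^ j)%N &
  q ^+ j <= `|BH (grid j k.+1) w - BH (grid j k) w|].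

Let H0 : 0 < H. Proof. exact: lt_trans gammaH. Qed.

Let q_gt0 : 0 < q. Proof. by rewrite powR_gt0. Qed.

Let powR_half_lt1 x : 0 < x -> 2^-1 `^ x < 1 :> R.
Proof.
move=> x0; have : 2^-1 `^ x < 1 `^ x :> R.
  by apply: gt0_ltr_powR => //; rewrite ?nnegrE//; lra.
by rewrite [in ltRHS]powR1.
Qed.

Let q_lt1 : q < 1. Proof. exact: powR_half_lt1. Qed.

Let powR_half_pow x j : ((2 ^ j)%:R^-1 : R) `^ x = (2^-1 `^ x) ^+ j.
Proof.
rewrite natrX -exprVn -powR_mulrn ?invr_ge0//.
by rewrite powRAC powR_mulrn// powR_ge0.
Qed.

(** An increment of level [j] has deviation v_j = T^H 2^(-jH), smaller than the threshold q^j by the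
    factor A r^j with r = 2^(-(H - gamma)) < 1. The Gaussian tail thus decays faster than any power
    of 2^(-j) and outweighs the 2^j increments of the union bound. *)
Let jump_null : outer_prob P (lim_sup_set jump) = 0%E.
Proof.
pose r : R := 2^-1 `^ (H - gamma).
have r0 : 0 < r by rewrite powR_gt0.
have r1 : r < 1 by apply: powR_half_lt1; rewrite subr_gt0.
have qr : 2^-1 `^ H = q * r.
  rewrite /q /r -powRD; first by congr powR; ring.
  by apply/implyP.
pose A := T `^ H; have A0 : 0 < A by rewrite powR_gt0.
pose v j := A * (q * r) ^+ j.
have v0 j : 0 < v j by rewrite mulr_gt0// exprn_gt0// mulr_gt0.
have vE j k : `|grid j k.+1 - grid j k| `^ H = v j.
  have -> : grid j k.+1 - grid j k = T / (2 ^ j)%:R by rewrite /grid -natr1; ring.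
  rewrite ger0_norm ?divr_ge0 ?(ltW T0)//.
  by rewrite powRM ?invr_ge0 ?(ltW T0)// powR_half_pow qr.
(* This [p] makes each tail O(4^(-j)), so that the union over 2^j increments is O(2^(-j)), a
   summable bound. *)
have [p p0 rp] : exists2 p, (0 < p)%N & (r ^+ p) ^+ 2 <= 4^-1.
  have half0 : 0 < 2^-1 :> R by [].
  have [N HN] := expr_eventually_le (introT andP (conj r0 r1)) half0.
  exists N.+1 => //.
  have -> : 4^-1 = 2^-1 ^+ 2 :> R by rewrite exprVn; congr (_^-1); ring.
  by rewrite ler_pXn2r ?nnegrE ?exprn_ge0 ?(ltW r0)// HN.
have A28 : 0 < (28 * A)^-1 by rewrite invr_gt0 mulr_gt0.
(* From level [J] on, q^j >= 28 v_j, as [gaussian_tail] demands. *)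
have [J HJ] := expr_eventually_le (introT andP (conj r0 r1)) A28.
pose K : R := 2 * (p%:R * (100 * A ^+ 2)) ^+ p.
have K0 : 0 <= K by rewrite mulr_ge0// exprn_ge0// mulr_ge0// mulr_ge0// sqr_ge0.
apply: (@outer_borel_cantelli _ _ _ P jump (fun j => K * 2^-1 ^+ j) J (2 * K)).
- by move=> j; rewrite mulr_ge0// exprn_ge0.
- by move=> n; exact: sum_geometric_half_le.
move=> j Jj; have qj0 : 0 < q ^+ j by rewrite exprn_gt0.
have rj0 : 0 < r ^+ j by rewrite exprn_gt0.
apply: (@le_trans _ _ ((2 ^ j)%:R * (K * 4^-1 ^+ j))%:E); last first.
  rewrite lee_fin natrX mulrCA -exprMn.
  by have -> : 2 * 4^-1 = 2^-1 :> R by field.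
apply: outer_prob_bigcup_le => k kj.
have gT i : (i <= 2 ^ j)%N -> grid j i \in `[0, T].
  move=> ij; rewrite in_itv/= mulr_ge0 ?divr_ge0 ?(ltW T0)//=.
  rewrite /grid mulrA ler_pdivrMr ?ltr0n ?expn_gt0// mulrC ler_pM2l// ler_nat.
  exact: ij.
pose V := (BH (grid j k.+1) \- BH (grid j k))%R : {RV P >-> R}.
have Vgauss : gaussian_var P V.
  have [gs _ _ _] := hBH.
  have := gs [:: (1, grid j k.+1); (-1, grid j k)].
  have -> : (fun w => \sum_(p <- [:: (1, grid j k.+1); (-1, grid j k)])
      p.1 * BH p.2 w) = V.
    by apply/funext => w; rewrite !big_cons big_nil/= mul1r addr0 mulN1r.
  apply=> z; rewrite !inE => /orP[] /eqP -> /=; first exact: gT.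
  exact/gT/ltnW.
have cheb x : 0 < x -> (P [set w | (x <= `|V w|)%R] <= (v j ^+ 2 / x ^+ 2)%:E)%E.
  move=> x0; have := @fbm_increment_chebyshev _ _ _ P H T BH (grid j k)
    (grid j k.+1) x hBH (gT _ (ltnW kj)) (gT _ kj) x0 H0.
  by rewrite vE.
have vq : 28 * v j <= q ^+ j.
  rewrite /v exprMn.
  have -> : 28 * (A * (q ^+ j * r ^+ j)) = q ^+ j * (28 * A * r ^+ j) by ring.
  rewrite ler_piMr ?(ltW qj0)// mulrC -ler_pdivlMr ?mulr_gt0// mul1r.
  exact: HJ.
have mE : measurable [set w | (q ^+ j <= `|V w|)%R].
  have := measurable_norm_ge 0 (q ^+ j) => mA.
  rewrite (_ : [set w | _] = V @^-1` [set x | (q ^+ j <= `|x - 0|)%R]).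
    by rewrite -[X in measurable X]setTI; apply: (measurable_funP V).
  by apply/seteqP; split => w /=; rewrite subr0.
rewrite outer_prob_measurable//.
apply: (le_trans (gaussian_tail (v0 j) cheb Vgauss vq)).
rewrite lee_fin /K -mulrA ler_pM2l//.
have x0 : 0 < (q ^+ j) ^+ 2 / (100 * v j ^+ 2).
  by apply: divr_gt0; [exact: exprn_gt0|apply: mulr_gt0 => //; exact: exprn_gt0].
apply: (le_trans (expRN_le_power p0 x0)).
have -> : p%:R / ((q ^+ j) ^+ 2 / (100 * v j ^+ 2)) =
    p%:R * (100 * A ^+ 2) * (r ^+ j) ^+ 2.
  rewrite /v [(q * r) ^+ j]exprMn; move: (q ^+ j) (r ^+ j) p%:R (A) qj0 rj0 A0 => a c n B a0 c0 B0.
  by field; rewrite !gt_eqF.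
rewrite exprMn ler_wpM2l ?exprn_ge0 ?mulr_ge0 ?exprn_ge0 ?(ltW A0)//.
have -> : ((r ^+ j) ^+ 2) ^+ p = ((r ^+ p) ^+ 2) ^+ j.
  by rewrite -!exprM; congr (_ ^+ _); rewrite mulnCA [RHS]mulnCA [(p * j)%N]mulnC.
by rewrite lerXn2r ?nnegrE ?sqr_ge0.
Qed.

Lemma fbm_modulus : outer_prob P [set w | ~ exists K N : nat, 
   forall n s t, (N <= n)%N -> s \in `[0, T] -> t \in `[0, T] ->
     `|s - t| <= T / (n ^ 2)%:R ->
     `|BH s w - BH t w| <= K%:R * n%:R `^ (- (2 * gamma))] = 0%E.
Proof.
have [_ _ _ cB] := hBH.
have N1 := outer_prob_negligible cB.
apply/eqP; rewrite eq_le outer_prob_ge0 andbT -(outer_probU0 N1 jump_null).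
apply: le_outer_prob => w nw; apply: contrapT => /not_orP[/contrapT cw jw].
apply: nw.
have [J HJ] : exists J, forall j, (J <= j)%N -> ~ jump j w.
  apply: contrapT => /forallNP HJ; apply: jw => J _.
  have /existsNP[j /not_implyP[Jj /contrapT jj]] := HJ J.
  by exists j.
have incr j k : (J <= j)%N -> (k < 2 ^ j)%N ->
   `|BH (k.+1%:R * (T / (2 ^ j)%:R)) w - BH (k%:R * (T / (2 ^ j)%:R)) w| <= q ^+ j.
  move=> Jj kj; rewrite leNgt; apply/negP => /ltW jmp.
  by apply: (HJ j Jj); exists k.
have mod := dyadic_modulus T0 q_gt0 q_lt1 cw incr.
(* The division by [q] pays for one level: with 2^j <= n^2 < 2^(j+1), it is q^(j+1), not q^j, that
   is at most n^(-2 gamma). *)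
pose K0 : R := (2 * (q / (1 - q)) + 1) / q.
have K00 : 0 <= K0.
  by rewrite divr_ge0 ?(ltW q_gt0)// addr_ge0// mulr_ge0// divr_ge0 ?subr_ge0 ?(ltW q_gt0) ?(ltW q_lt1).
exists (Num.truncn K0).+1, (2 ^ J)%N => n s t Jn sT tT st.
have n0 : (0 < n)%N by rewrite (leq_trans _ Jn)// expn_gt0.
have n20 : (0 < n ^ 2)%N by rewrite expn_gt0 n0.
pose j := trunc_log 2 (n ^ 2).
have jn : (2 ^ j <= n ^ 2)%N by exact: trunc_logP.
have nj : (n ^ 2 < 2 ^ j.+1)%N by exact: trunc_log_ltn.
have Jj : (J <= j)%N.
  apply: trunc_log_max => //; rewrite (leq_trans Jn)//.
  by rewrite -[X in (X <= _)%N]expn1 leq_pexp2l.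
have stj : `|s - t| <= T / (2 ^ j)%:R.
  rewrite (le_trans st)// ler_pM2l// lef_pV2 ?posrE ?ltr0n//; last by rewrite expn_gt0.
  by rewrite ler_nat.
apply: (le_trans (mod j s t Jj sT tT stj)).
have -> : (2 * (q / (1 - q)) + 1) * q ^+ j = K0 * q ^+ j.+1.
  by rewrite exprS /K0; field; rewrite gt_eqF//= subr_eq0 gt_eqF.
apply: ler_pM => //; first by rewrite exprn_ge0// ltW.
  exact/ltW/truncnS_gt.
rewrite /q -powR_half_pow.
have -> : n%:R `^ (- (2 * gamma)) = ((n ^ 2)%:R^-1 : R) `^ gamma.
  rewrite natrX -powR_mulrn// -powRN -powRrM.
  by congr powR; ring.
rewrite ge0_ler_powR ?(ltW gamma0)// ?nnegrE ?invr_ge0//.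
by rewrite lef_pV2 ?posrE ?ltr0n// ?ler_nat ?expn_gt0 ?n0//; exact: ltnW.
Qed.

End fbm_modulus.

(** * Conclusion *)

Lemma powR_eventually_ge (R : realType) (a K : R) : 0 < a ->
  exists N : nat, forall n, (N <= n)%N -> K <= (n%:R : R) `^ a.
Proof.
move=> a0; pose M := Num.max K 0; have M0 : 0 <= M by rewrite le_max lexx orbT.
exists (Num.truncn (M `^ a^-1)).+1 => n Nn.
apply: (@le_trans _ _ M); first by rewrite le_max lexx.
have -> : M = (M `^ a^-1) `^ a by rewrite -powRrM mulVf ?gt_eqF// powRr1.
rewrite ge0_ler_powR ?(ltW a0) ?nnegrE ?powR_ge0//.
by rewrite (le_trans (ltW (truncnS_gt _)))// ler_nat.
Qed.

(** Raise s * ln x = ln (x^s) <= x^s to the power [p]. *)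
Lemma ln_powR_le (R : realType) (s p x : R) : 0 < s -> 0 <= p -> 1 <= x ->
  ln x `^ p <= s^-1 `^ p * x `^ (s * p).
Proof.
move=> s0 p0 x1; have x0 : 0 < x by rewrite (lt_le_trans _ x1).
rewrite powRrM -powRM ?invr_ge0 ?(ltW s0) ?powR_ge0//.
rewrite ge0_ler_powR ?nnegrE ?ln_ge0 ?mulr_ge0 ?invr_ge0 ?(ltW s0) ?powR_ge0//.
rewrite mulrC ler_pdivlMr//.
have -> : ln x * s = ln (x `^ s) by rewrite ln_powR mulrC.
have xs : 0 < x `^ s by rewrite powR_gt0.
have := @le_ln1Dx _ (x `^ s - 1); rewrite subrKC => H.
by rewrite (le_trans (H _))//; lra.
Qed.

(** Half of the decay n^(-rho) is spent on the logarithm, by [ln_powR_le] with s = rho/5. The first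
    conclusion secures [e <= 1] in the pathwise bound; the second lets n^delta absorb a
    path-dependent [K]. *)
Lemma powR_ln_absorb (R : realType) (rho delta K : R) : 0 < rho -> 0 < delta ->
  0 <= K -> exists N : nat, forall n, (N <= n)%N ->
    K * ((n%:R : R) `^ (- rho) * ln n%:R `^ (5 / 2)) <= 1 /\
    K * (n%:R `^ (- rho) * ln n%:R `^ (5 / 2))
      <= n%:R `^ (- rho + delta) * ln n%:R `^ (5 / 2).
Proof.
move=> r0 d0 K0; pose c : R := (rho / 5)^-1 `^ (5 / 2).
have [N1 H1] := powR_eventually_ge (K * c) (divr_gt0 r0 (ltr0n _ 2 : 0 < 2%:R)).
have [N2 H2] := powR_eventually_ge K d0.
exists (maxn 1 (maxn N1 N2)) => n; rewrite !geq_max => /and3P[n1 /H1 {}H1 /H2 {}H2].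
have n0 : 0 < n%:R :> R by rewrite ltr0n.
split.
  have L : ln n%:R `^ (5 / 2) <= c * n%:R `^ (rho / 2).
    have := @ln_powR_le R (rho / 5) (5 / 2) n%:R.
    have -> : rho / 5 * (5 / 2) = rho / 2 by field.
    by apply; rewrite ?divr_gt0 ?divr_ge0 ?ler1n.
  have E : n%:R `^ (- rho) = (n%:R `^ (rho / 2) * n%:R `^ (rho / 2))^-1 :> R.
    have rr : rho = rho / 2 + rho / 2 by field.
    by rewrite powRN {1}rr powRD// (gt_eqF n0) implybT.
  apply: (@le_trans _ _ (K * (n%:R `^ (- rho) * (c * n%:R `^ (rho / 2))))).
    by rewrite ler_wpM2l// ler_wpM2l// powR_ge0.
  rewrite E; move: (powR_gt0 (rho / 2) n0) H1; move: (n%:R `^ _) => z z0 H1.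
  have -> : K * ((z * z)^-1 * (c * z)) = K * c / z by field; rewrite gt_eqF.
  by rewrite ler_pdivrMr// mul1r.
rewrite powRD; last by rewrite (gt_eqF n0) implybT.
rewrite -mulrA [leRHS]mulrCA.
by rewrite ler_wpM2r// mulr_ge0 ?powR_ge0.
Qed.

Lemma sup_exceedsPn (R : realType) (d : measure_display)
    (Omega : measurableType d) (T : R) (X Y : R -> Omega -> R) (c : R) w :
  ~ sup_exceeds T X Y c w <-> forall t, t \in `[0, T] -> `|X t w - Y t w| <= c.
Proof.
rewrite /sup_exceeds /=; split => [/negP|H].
  rewrite -leNgt => H t tT; rewrite -lee_fin; apply: le_trans H.
  by apply: ereal_sup_ubound; exists t.
apply/negP; rewrite -leNgt; apply: ge_ereal_sup => _ [t tT <-].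
by rewrite lee_fin; exact: H.
Qed.

Lemma lim_sup_setPn (T : Type) (F : (set T)^nat) w :
  ~ lim_sup_set F w <-> exists N, forall n, (N <= n)%N -> ~ F n w.
Proof.
split=> [H|[N HN] /(_ N Logic.I)[n /= Nn]]; last exact: HN.
apply: contrapT => /forallNP HN; apply: H => N _.
have /existsNP[n /not_implyP[Nn /contrapT Fn]] := HN N.
by exists n.
Qed.

Lemma littleo_outer_borel_cantelli (R : realType) (d : measure_display)
    (Omega : measurableType d) (P : probability Omega R) (F : (set Omega)^nat) :
  (fun n => fine (outer_prob P (F n))) =o_\oo (fun n : nat => n%:R `^ (- 2)) ->
  outer_prob P (lim_sup_set F) = 0%E.
Proof.
move=> /eqoP/(_ 1 ltr01)[N _ HN].
apply: (outer_borel_cantelli (u := fun n => n%:R `^ (- 2)) (N := N) (C := 2)).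
- by move=> n; exact: powR_ge0.
- exact: sum_inv_sqr_le.
- move=> n Nn; have := HN n Nn; rewrite /= mul1r (ger0_norm (powR_ge0 _ _)).
  rewrite ger0_norm ?fine_ge0 ?outer_prob_ge0// -lee_fin fineK//.
  rewrite ge0_fin_numE ?outer_prob_ge0//.
  by rewrite (le_lt_trans (outer_prob_le1 _ _))// ltry.
Qed.

Unset Implicit Arguments.

Theorem theorem3p3
  (R : realType) (d : measure_display) (Omega : measurableType d)
  (P : probability Omega R)
  (T H x0 a beta CH : R) (b sigma : R -> R)
  (B BH : R -> {RV P >-> R})
  (Z1 Z2 Z3 : nat -> R -> Omega -> R)
  (h : R -> R -> R) (X Y : R -> Omega -> R)
  (J : (R -> Omega -> R) -> (R -> Omega -> R) -> (R -> Omega -> R) -> Prop)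
  (hT : 0 < T) (hH : 0 < H < 1) (hH2 : H != 2^-1) (ha : a < 0)
  (hb : C_b 1 b) (hsigma : C_b 2 sigma)
  (hbeta : `|H - 2^-1| < beta < 2^-1)
  (hB : two_sided_brownian B)
  (hBH : fractional_brownian H T BH)
  (hCH : 0 < CH) (hrepr : mandelbrot_van_ness P CH H T B BH)
  (hh : flow sigma h)
  (hY : doss_pathwise_solution P T x0 b sigma h BH Y)
  (hX : unique_sde_solution P J T x0 b sigma BH X)
  (hDS : {ae P, forall w, forall t, t \in `[0, T] ->
            X t w = h (Y t w) (BH t w)})
  (hZ1 : forall n, (0 < n)%N -> transport_process P n (Z1 n))
  (hZ2 : forall n, (0 < n)%N -> transport_process P n (backward (Z2 n)))
  (hZ3 : forall n, (0 < n)%N -> transport_process P n (backward (Z3 n)))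
  (hA1 : strongly_approximates P 0 T Z1 B)
  (hA2 : strongly_approximates P a 0 Z2 B)
  (hA3 : strongly_approximates P a^-1 0 Z3 (inverted B))
  (hknown : forall q : R, 0 < q -> exists2 C : R, 0 < C &
     (fun n : nat => fine (outer_prob P
        (sup_exceeds T BH (fbm_approx CH H beta a Z1 Z2 Z3 n)
           (C * n%:R `^ (- 2^-1 + beta) * ln n%:R `^ (5 / 2)))))
     =o_\oo (fun n : nat => n%:R `^ (- q))) :
  forall delta : R, 0 < delta -> delta < beta -> beta + delta < 2^-1 ->
  exists2 C : R, 0 < C &
    outer_prob P (lim_sup_set (fun n : nat =>
      sup_exceeds T X
        (sde_approx T x0 b sigma (fbm_approx CH H beta a Z1 Z2 Z3) n)
        (C * n%:R `^ (- 2^-1 + beta + delta) * ln n%:R `^ (5 / 2)))) = 0%E.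
Proof.
move=> delta delta0 _ _; exists 1 => //.
have [betaH beta2] := andP hbeta; have [H0 H1] := andP hH.
pose rho := 2^-1 - beta; have rho0 : 0 < rho by rewrite subr_gt0.
have rhoH : rho < H.
  by move: betaH; rewrite ltr_norml /rho => /andP[]; lra.
have rhoE : - 2^-1 + beta = - rho by rewrite /rho; ring.
have [C C0 known] := hknown 2 (ltr0Sn R 1).
have nullA := littleo_outer_borel_cantelli known.
have gamma0 : 0 < rho / 2 by rewrite divr_gt0.
have gammaH : rho / 2 < H by lra.
have nullB := fbm_modulus hT gamma0 gammaH hBH.
have [_ _ _ /outer_prob_negligible nullC] := hBH.
have /outer_prob_negligible nullY := hY.
have /outer_prob_negligible nullX := hDS.
have null := outer_probU0 (outer_probU0 nullA nullB)
  (outer_probU0 nullC (outer_probU0 nullY nullX)).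
(* It remains to show that the limit superior lies in the union of the five null sets; for [w]
   outside this union the argument is deterministic. *)
apply/eqP; rewrite eq_le outer_prob_ge0 andbT -{}null.
apply: le_outer_prob => w; apply: contraPP.
move=> /not_orP[/not_orP[/lim_sup_setPn[N1 approx] /contrapT[K2 [N2 osc]]]].
move=> /not_orP[/contrapT cB /not_orP[/contrapT[cY Y0 dY] /contrapT DS]].
apply/lim_sup_setPn.
have [M BM] : exists M, forall t, t \in `[0, T] -> `|BH t w| <= M.
  have cnB : {within `[0, T], continuous (fun t => `|BH t w|)}.
    move=> t; apply: continuous_comp; [exact: cB|exact: norm_continuous].
  by have [c _ cmax] := EVT_max (ltW hT) cnB; exists `|BH c w|.
have [K K0 [N0 bound]] := sde_euler_pathwise hT hb hsigma hh BM cY Y0 dY.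
(* [C] bounds the approximation error and [K2] the oscillation, so a single [e] dominates both. *)
pose K1 : R := C + K2%:R.
have K10 : 0 <= K1 by rewrite addr_ge0// ltW.
have KK : 0 <= K * (K1 + 1) by rewrite mulr_ge0// addr_ge0.
have [N3 absorb3] := powR_ln_absorb rho0 delta0 K10.
have [N4 absorb4] := powR_ln_absorb rho0 delta0 KK.
(* The oscillation and the term 1/n carry no logarithm; a logarithmic factor of at least 1 puts them
   under the common rate [u * L]. *)
have [N5 ln_ge1] : exists N : nat, forall n, (N <= n)%N -> 1 <= ln n%:R :> R.
  exists (Num.truncn (expR 1 : R)).+1 => n Nn.
  have En : expR 1 <= n%:R :> R.
    by rewrite (le_trans (ltW (truncnS_gt _)))// ler_nat.
  rewrite -[leLHS](@expRK R) ler_ln ?posrE ?expR_gt0//.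
  by rewrite (lt_le_trans _ En)// expR_gt0.
exists (maxn N0 (maxn N1 (maxn N2 (maxn N3 (maxn N4 (maxn N5 1)))))) => n.
rewrite !geq_max.
case/and5P => nN0 nN1 nN2 nN3 /and3P[nN4 nN5 n0].
apply/sup_exceedsPn => t tT.
have n0' : 0 < n%:R :> R by rewrite ltr0n.
set L := ln n%:R `^ (5 / 2).
have L1 : 1 <= L.
  rewrite -[leLHS](powRr0 (ln n%:R)) ler_powR ?ln_ge1//; lra.
set u := n%:R `^ (- rho).
have u0 : 0 <= u by exact: powR_ge0.
have uL : u <= u * L by rewrite ler_peMr.
have uL0 : 0 <= u * L by exact: le_trans uL.
(* 1/n is below n^(-rho) because rho = 1/2 - beta <= 1. *)
have ninv : n%:R^-1 <= u * L.
  rewrite (le_trans _ uL)// /u -powR_inv1 ?ler0n// ler_powR ?ler1n//.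
  have beta0 : 0 < beta by exact: le_lt_trans betaH.
  by rewrite lerN2 lerBlDr (@le_trans _ _ 1) ?lerDl ?(ltW beta0)// invf_le1// ler1n.
pose e := K1 * (u * L).
have e1 : e <= 1 by have [] := absorb3 n nN3.
have appr s : s \in `[0, T] ->
    `|BH s w - fbm_approx CH H beta a Z1 Z2 Z3 n s w| <= e.
  move=> sT; have /sup_exceedsPn/(_ s sT) := approx n nN1.
  rewrite rhoE -/u -/L -mulrA => /le_trans; apply.
  by rewrite /e ler_wpM2r// lerDl.
have osc' s r : s \in `[0, T] -> r \in `[0, T] ->
    `|s - r| <= T / (n ^ 2)%:R -> `|BH s w - BH r w| <= e.
  move=> sT rT sr; rewrite (le_trans (osc n s r nN2 sT rT sr))//.
  have -> : 2 * (rho / 2) = rho by field.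
  rewrite -/u; apply: (@le_trans _ _ (K2%:R * (u * L))).
    by rewrite ler_wpM2l.
  by rewrite /e ler_wpM2r// lerDr ltW.
rewrite DS//.
rewrite (le_trans (bound n (fun s => fbm_approx CH H beta a Z1 Z2 Z3 n s w) e
  nN0 e1 appr osc' t tT))//.
rewrite mul1r -/L rhoE; have [_] := absorb4 n nN4; apply: le_trans.
have -> : K * (K1 + 1) * (u * L) = K * (e + u * L) by rewrite /e; ring.
by rewrite ler_wpM2l// lerD2l.
Qed.
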